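(* Consider the control-free case. Suppose that either (i) $\{X_t\}$ is stationary; or (ii) $\mathbb{X},\mathbb{Y},\mathbb{U}$ are compact, $Q(\cdot|x)$ and $\mathcal{T}(\cdot|x)$ are weakly continuous in $x$, and either $\{X_t\}$ is stationary, or the stochastic kernel $\kappa(dx|y)=P(X_t\in dx|Y_{(-\infty,t]}=y)$ is weakly continuous in $y$ (product topology) and, for every Borel $B\subset\mathbb{X}$ and almost every $y$, $P(X_t\in B|Y_{(-\infty,t]}=y)=P(X_{t+1}\in B|Y_{(-\infty,t+1]}=y)$; and, in addition, the filter $\pi_t$ is $\sigma(Y_{(-\infty,t]})$-measurable (in particular, there exists a measurable $g$ with $g(Y_{(-\infty,t]})(A)=\pi_t(A)$ for every Borel $A$). Then the filter process admits an invariant probability measure.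
   Context: Model (control-free): $\mathbb{X}$, $\mathbb{Y}$ are standard Borel (Polish) spaces. $\{X_t\}$ is a Markov chain with kernel $\mathcal{T}(B|x)=P(X_{t+1}\in B|X_t=x)$, and $Y_t=G(X_t,V_t)$ with $V_t$ i.i.d. and independent of the state noise; $Q(C|x)=P(Y_t\in C|X_t=x)$. $\mathbb{U}$ is the decision space; decisions affect only the cost. Infinite past: measurements are assumed to have been taking place since $-\infty$ (a stationary one-sided process is extended to a two-sided one); $\mathbb{Y}^{\mathbb{Z}_-}$ is the one-sided product over $\{\dots,-1,0\}$ with the product topology, and $Y_{(-\infty,t]}$ is viewed as $\mathbb{Y}^{\mathbb{Z}_-}$-valued. The filter process $\pi_t\in\mathcal{P}(\mathbb{X})$ (weak topology) is the conditional distribution of $X_t$ given the measurements and distant prior beliefs, $\pi_t(A)=E[1_{\{X_t\in A\}}\,|\,\sigma(Y_{(-\infty,t]})\vee\sigma(\pi_{(-\infty,-n]})]$ for every $n$; it is a $\mathcal{P}(\mathbb{X})$-valued Markov process, and its invariant probability measures are those of its transition kernel. *)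

(* Defs.v *)
From HB Require Import structures.
From mathcomp Require Import all_boot all_order all_algebra.
From mathcomp Require Import all_classical all_reals all_analysis.
From mathcomp Require Import measurable_realfun.

Set Implicit Arguments.
Unset Strict Implicit.
Unset Printing Implicit Defensive.

Import Order.TTheory GRing.Theory Num.Theory.
Import numFieldNormedType.Exports.

Local Open Scope classical_set_scope.
Local Open Scope ring_scope.

Definition borel (T : ptopologicalType) : measurableType (@open T).-sigma :=
  g_sigma_algebraType (@open T).

(* With a complete metric carried by the type, this makes T a Polish space. *)
Definition polish (R : realType) (T : completePseudoMetricType R) : Prop :=
  hausdorff_space T /\ exists2 D : set T, countable D & dense D.

Section weak_topology.
Context (X : ptopologicalType) (R : realType).

Definition bounded_continuous : Type :=
  {f : X -> R | continuous f /\ bounded_fun f}.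

HB.instance Definition _ := gen_eqMixin bounded_continuous.
HB.instance Definition _ := gen_choiceMixin bounded_continuous.

(* Same carrier as the library's [pprobability], but with the weak topology,
   whose Borel sets are those of [borel (wprobability X R)]. *)
Definition wprobability : Type := probability (borel X) R.

HB.instance Definition _ :=
  Pointed.copy wprobability (probability (borel X) R).

Definition weak_eval (p : wprobability) :
    prod_topology (fun _ : bounded_continuous => R) :=
  fun f => (\int[(p : probability (borel X) R)]_x sval f x)%R.

HB.instance Definition _ :=
  Topological.copy wprobability (initial_topology weak_eval).

End weak_topology.

Definition weakly_continuous (R : realType) (S X : ptopologicalType)
    (k : R.-pker (borel S) ~> (borel X)) : Prop :=
  forall f : X -> R, continuous f -> bounded_fun f ->
    continuous (fun s : S => (\int[k s]_x f x)%R).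

(* Y^{Z_-} with the product topology; the coordinate -k of the index set
   {..., -1, 0} is encoded by k : nat. *)
Definition past_space (Y : ptopologicalType) : Type := {ptws nat -> Y}.

HB.instance Definition _ (Y : ptopologicalType) :=
  Topological.copy (past_space Y) {ptws nat -> Y}.
HB.instance Definition _ (Y : ptopologicalType) :=
  isPointed.Build (past_space Y) (fun=> point).

Section processes.
Context d (Omega : measurableType d) (R : realType) (P : probability Omega R).

Definition sigma_of d' (S : measurableType d') (D : set int)
    (Z : int -> Omega -> S) : set (set Omega) :=
  <<s \bigcup_(t in D) g_sigma_algebra_preimage (Z t) >>.

Definition past_sigma d' (S : measurableType d') (Z : int -> Omega -> S)
    (t : int) : set (set Omega) :=
  sigma_of [set s | s <= t] Z.

Definition join_sigma (F G : set (set Omega)) : set (set Omega) :=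
  <<s F `|` G >>.

(* f is a version of the conditional probability P(E | H). *)
Definition cond_prob (H : set (set Omega)) (E : set Omega)
    (f : Omega -> \bar R) : Prop :=
  measurable_fun [set: g_sigma_algebraType H]
    (f : g_sigma_algebraType H -> \bar R) /\
  forall B, H B -> (\int[P]_(w in B) f w = P (B `&` E))%E.

Definition stationary d' (S : measurableType d')
    (Z : int -> Omega -> S) : Prop :=
  forall (h : int) (ts : seq int) (A : int -> set S),
    (forall t, measurable (A t)) ->
    P (\bigcap_(t in [set` ts]) (Z (t + h) @^-1` A t)) =
    P (\bigcap_(t in [set` ts]) (Z t @^-1` A t)).

Definition markov_chain d' (S : measurableType d') (T : R.-pker S ~> S)
    (Z : int -> Omega -> S) : Prop :=
  forall (t : int) (A : set S), measurable A ->
    cond_prob (past_sigma Z t) (Z (t + 1) @^-1` A) (fun w => T (Z t w) A).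

Definition iid d' (S : measurableType d') (V : int -> Omega -> S) : Prop :=
  (forall (s t : int) (A : set S), measurable A ->
     P (V s @^-1` A) = P (V t @^-1` A)) /\
  (forall (ts : seq int) (A : int -> set S), uniq ts ->
     (forall t, measurable (A t)) ->
     (P (\bigcap_(t in [set` ts]) (V t @^-1` A t)) =
      \prod_(t <- ts) P (V t @^-1` A t))%E).

Definition independent_processes d1 (S1 : measurableType d1)
    d2 (S2 : measurableType d2)
    (Z1 : int -> Omega -> S1) (Z2 : int -> Omega -> S2) : Prop :=
  forall A B, sigma_of [set: int] Z1 A -> sigma_of [set: int] Z2 B ->
    (P (A `&` B) = P A * P B)%E.

End processes.

Section partially_observed.
Context (R : realType) (X Y : completePseudoMetricType R).
Context dW (W : measurableType dW).
Context d (Omega : measurableType d) (P : probability Omega R).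

Record observed_markov_chain (T : R.-pker (borel X) ~> (borel X))
    (Q : R.-pker (borel X) ~> (borel Y))
    (G : {mfun (borel X * W)%type >-> borel Y})
    (Xt : int -> {RV P >-> borel X}) (Vt : int -> {RV P >-> W})
    (Yt : int -> {RV P >-> borel Y}) : Prop := ObservedMarkovChain {
  omc_markov : markov_chain P T Xt ;
  omc_noise_iid : iid P Vt ;
  omc_noise_indep : independent_processes P Xt Vt ;
  omc_obs : forall t w, Yt t w = G (Xt t w, Vt t w) ;
  (* Q(C|x) = P(Y_t \in C | X_t = x), which by the independence of V_t and X_t
     is the law of G(x, V_t) *)
  omc_channel : forall (t : int) (x : X) (C : set (borel Y)), measurable C ->
    Q x C = P [set w | C (G (x, Vt t w))] }.

Definition past (Yt : int -> {RV P >-> borel Y}) (t : int) (w : Omega) :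
    past_space Y :=
  fun k => Yt (t - k%:Z) w.

(* A weakly continuous kernel which, whatever t, is a version of
   P(X_t \in dx | Y_(-oo,t] = y): the conditional law does not depend on t. *)
Definition invariant_continuous_smoother
    (Xt : int -> {RV P >-> borel X}) (Yt : int -> {RV P >-> borel Y}) : Prop :=
  exists2 kappa : R.-pker (borel (past_space Y)) ~> (borel X),
    weakly_continuous kappa &
    forall (t : int) (B : set (borel X)), measurable B ->
      cond_prob P (past_sigma Yt t) (Xt t @^-1` B)
        (fun w => kappa (past Yt t w) B).

(* pi_t = E[1_{X_t \in .} | Y_(-oo,t], pi_(-oo,m]] for every m = -n not after
   t. *)
Definition filter_process
    (Xt : int -> {RV P >-> borel X}) (Yt : int -> {RV P >-> borel Y})
    (pit : int -> {RV P >-> borel (wprobability X R)}) : Prop :=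
  forall t m : int, m <= t -> forall A : set (borel X), measurable A ->
    cond_prob P (join_sigma (past_sigma Yt t) (past_sigma pit m))
      (Xt t @^-1` A) (fun w => (pit t w : probability (borel X) R) A).

Definition filter_past_measurable (Yt : int -> {RV P >-> borel Y})
    (pit : int -> {RV P >-> borel (wprobability X R)}) : Prop :=
  forall (t : int) (D : set (borel (wprobability X R))), measurable D ->
    past_sigma Yt t (pit t @^-1` D).

End partially_observed.

Section filter_kernel.
Context (R : realType) (X Y : completePseudoMetricType R).
Variables (T : R.-pker (borel X) ~> (borel X))
  (Q : R.-pker (borel X) ~> (borel Y)).
Variable
  F : {mfun (borel (wprobability X R) * borel Y)%type
        >-> borel (wprobability X R)}.
Local Open Scope ereal_scope.

(* F(p, y) is a regular version of P(X_1 \in dx | Y_1 = y) when X_0 has law p: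
   E[F(p, Y_1)(A); Y_1 \in C] = P(X_1 \in A, Y_1 \in C). *)
Definition filter_update : Prop :=
  forall (p : probability (borel X) R) (A : set (borel X)) (C : set (borel Y)),
    measurable A -> measurable C ->
    \int[p]_x \int[T x]_x1 \int[Q x1]_(y in C)
      (F (p, y) : probability (borel X) R) A =
    \int[p]_x \int[T x]_(x1 in A) Q x1 C.

(* The law of pi_1 = F(pi_0, Y_1) given pi_0 = p.  It does not depend on the
   choice of F among the maps satisfying [filter_update]. *)
Definition filter_kernel (p : borel (wprobability X R))
    (D : set (borel (wprobability X R))) : \bar R :=
  \int[(p : probability (borel X) R)]_x \int[T x]_x1
    Q x1 [set y | D (F (p, y))].

End filter_kernel.

Definition invariant_probability d (S : measurableType d) (R : realType)
    (K : S -> set S -> \bar R) (mu : probability S R) : Prop :=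
  forall D, measurable D -> (mu D = \int[mu]_p K p D)%E.

(* Main.v *)
Require Import Defs.
From HB Require Import structures.
From mathcomp Require Import all_boot all_order all_algebra.
From mathcomp Require Import all_classical all_reals all_analysis.
From mathcomp Require Import measurable_realfun giry.
From mathcomp Require Import ring lra zify.
Import Order.TTheory GRing.Theory Num.Theory.
Import numFieldNormedType.Exports.
Local Open Scope classical_set_scope.
Local Open Scope ring_scope.

(**
The filter kernel has an invariant probability as soon as the hidden chain has
one, say mu.  Start the hidden chain from mu and let h be the whole history
..., Y_(-1), Y_0 of observations.  The pair (h, X_0) has a stationary law lambda
for the transition that draws X_1 from T(X_0, .), Y_1 from Q(X_1, .) and
prepends Y_1 to the history: in the laws obtained by running the chain for n
steps, the last k observations and the current state do not depend on n >= k, so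
these laws have a projective limit.  Disintegrate lambda into g(h)(dx) = P(X_0 in
dx | h).  By stationarity and [filter_update], both g(Y_1 h) and F(g(h), Y_1) are
versions of the law of X_1 given (h, Y_1), hence almost surely equal, so the law
of g(h) is invariant under the filter kernel.

For a stationary chain, mu is the law of X_0.  In the compact case, mu comes from
the Krylov-Bogoliubov theorem, because T is Feller.

All the measures needed (projective limits, conditional laws, limits of Cesaro
means) are built on the Cantor space: additive weights on finite bit strings give
a probability by pushing the Lebesgue measure of [0, 1] through a quantile map,
and a Polish space is a measurable retract of the Cantor space.
*)
Set Implicit Arguments.
Unset Strict Implicit.
Unset Printing Implicit Defensive.

(** * Measures on bit sequences *)

(** The map [F] is only measurable, so the filter kernel need not be Feller, and limits of averages
    along the filter process need not be invariant. Limits are therefore taken below the filter: for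
    the hidden chain, whose kernel is Feller in the compact case, and for events that read finitely
    many bits, whose masses are bounded real sequences. They are taken along an ultrafilter finer
    than [\oo], where all these sequences converge at once and no subsequence has to be extracted. A
    second obstacle is that conditional probabilities are determined only up to a null set for each
    event. Almost sure identities are therefore checked on the countably many cylinders, so that a
    single null set suffices. Moreover, two elements of [probability] that agree on measurable sets
    need not be equal as functions on all sets; what saves the argument is that Borel sets of the
    weak topology cannot separate them. *)

Section push.
Context d d' (A : measurableType d) (B : measurableType d') (R : realType).
Variables (f : A -> B) (mf : measurable_fun setT f) (m : probability A R).

Definition push_probability : probability B R :=
  distribution m (mfun_Sub (mem_set mf)).

Lemma push_probabilityE U : push_probability U = m (f @^-1` U).
Proof. by []. Qed.

Lemma integral_push (g : B -> \bar R) : measurable_fun setT g ->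
  (forall y, 0 <= g y)%E ->
  (\int[push_probability]_y g y = \int[m]_x g (f x))%E.
Proof.
by move=> mg g0; rewrite ge0_integral_pushforward// => y _; exact: g0.
Qed.

End push.

Lemma integral_probability_cst d (T : measurableType d) (R : realType)
  (m : probability T R) c : (\int[m]_x c = c)%E.
Proof. by rewrite integral_cst//= probability_setT mule1. Qed.

Definition coordinate_sets : set (set (nat -> bool)) :=
  [set A | exists n, A = [set c : nat -> bool | c n]].

Definition bits := g_sigma_algebraType coordinate_sets.

(* The most recently read bit comes first, so that extending a prefix is a
   [cons]. *)
Fixpoint prefix_rev (c : bits) n : seq bool :=
  if n is n'.+1 then c n' :: prefix_rev c n' else [::].

Definition cylinder (s : seq bool) : set bits :=
  [set c | prefix_rev c (size s) = s].

(** Over all [n] these are the clopen sets of the Cantor space: an algebra that generates [bits],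
    and on which limits of measures are taken setwise. *)
Definition depends_below n (A : set bits) :=
  forall c c' : bits, (forall i, (i < n)%N -> c i = c' i) -> A c -> A c'.

Lemma measurable_coordinate n : measurable [set c : bits | c n].
Proof. by apply: sub_sigma_algebra; exists n. Qed.

Lemma measurable_fun_bits d (A : measurableType d) (f : A -> bits) :
  (forall n, measurable [set a | f a n]) -> measurable_fun setT f.
Proof.
move=> mf; apply: (@measurability _ _ A bits setT f coordinate_sets) => //.
by move=> _ [_ [n ->] <-]; rewrite setTI; exact: mf.
Qed.

Lemma prefix_rev_eq c c' n :
  prefix_rev c n = prefix_rev c' n <-> forall i, (i < n)%N -> c i = c' i.
Proof.
split=> [|].
  elim: n => [//|n IH] /= [e1 /IH e2] i; rewrite ltnS leq_eqVlt => /predU1P[->//|].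
  exact: e2.
elim: n => //= n IH e; rewrite e// IH// => i ni; apply: e; exact: ltnW.
Qed.

Lemma cylinder_cons s : cylinder s = cylinder (true :: s) `|` cylinder (false :: s).
Proof.
apply/seteqP; split => c; rewrite /cylinder/=.
  by move=> e; case h: (c (size s)); [left|right]; rewrite e.
by move=> [|] [].
Qed.

Lemma cylinder_cons_disj s : cylinder (true :: s) `&` cylinder (false :: s) = set0.
Proof. by apply/seteqP; split => c //= [] [e _] [e2 _]; rewrite e in e2. Qed.

Lemma measurable_cylinder s : measurable (cylinder s).
Proof.
elim: s => [|b s IH].
  by rewrite (_ : cylinder _ = setT)//; apply/seteqP; split.
rewrite (_ : cylinder _ = (if b then [set c : bits | c (size s)] else ~` [set c :
  bits | c (size s)]) `&` cylinder s).
  apply: measurableI => //; case: b.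
    exact: measurable_coordinate.
  by apply: measurableC; exact: measurable_coordinate.
apply/seteqP; split => c; rewrite /cylinder/=.
  by move=> [e ->]; split=> //; case: b e => /= ->.
move=> [e ->]; congr cons; case: b e => /=; case: (c _) => // e; case: e.
Qed.

Lemma cylinderI_depends n A s : depends_below n A -> (n <= size s)%N ->
  cylinder s `&` A = cylinder s \/ cylinder s `&` A = set0.
Proof.
move=> dA ns; have [[c [sc Ac]]|no] := pselect (exists c, cylinder s c /\ A c).
  left; apply/seteqP; split => [c' []//|c' sc']; split=> //.
  apply: dA Ac => i ni; have /prefix_rev_eq : prefix_rev c (size s)
    = prefix_rev c' (size s).
    by rewrite sc sc'.
  by apply; exact: leq_trans ns.
by right; apply/seteqP; split => c // cA; apply: no; exists c.
Qed.

(** A set that reads [n] bits is a finite disjoint union of cylinders. Cutting cylinders one bit at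
    a time stops at length [n], where each piece lies inside [A] or misses it; the last premise
    glues the two halves back. *)
Lemma depends_ind (Q : set bits -> Prop) n A : depends_below n A ->
  Q set0 -> (forall s, Q (cylinder s)) ->
  (forall s, Q (cylinder (true :: s) `&` A) -> Q (cylinder (false :: s) `&` A) ->
     Q (cylinder s `&` A)) ->
  Q A.
Proof.
move=> dA Q0 Qs Qc.
suff H k s : (n <= size s + k)%N -> Q (cylinder s `&` A).
  have := H n [::] (leqnn _); rewrite (_ : cylinder _ = setT) ?setTI//.
  by apply/seteqP; split.
elim: k s => [|k IH] s.
  by rewrite addn0 => ns; case: (cylinderI_depends dA ns) => ->.
by move=> h; apply: Qc; apply: IH; rewrite /= addSnnS.
Qed.

Lemma measurable_depends n A : depends_below n A -> measurable A.
Proof.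
move=> dA; apply: (@depends_ind measurable _ _ dA) => //;
  first exact: measurable_cylinder.
move=> s m1 m2; rewrite cylinder_cons setIUl; exact: measurableU.
Qed.

Lemma depends_cylinder s : depends_below (size s) (cylinder s).
Proof. 
move=> c c' e cs; rewrite /cylinder/= -[RHS]cs; apply/prefix_rev_eq => i /e ->.
by [].
Qed.

Lemma bits_measurableE : (@measurable _ bits) = <<s [set A | exists n,
  depends_below n A] >>.
Proof.
apply/seteqP; split.
  apply: (@smallest_sub _ _ _ <<s [set A | exists n,
    depends_below n A] >> (smallest_sigma_algebra _ _)) => _ [n ->].
  by apply: sub_sigma_algebra; exists n.+1 => c c' /(_ n (leqnn _)) /= ->.
apply: (@smallest_sub _ _ _ measurable (@sigma_algebra_measurable _ bits)).
by move=> B [n]; exact: measurable_depends.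
Qed.

Lemma setI_closed_depends : setI_closed [set A | exists n, depends_below n A].
Proof.
move=> B C [n dB] [m dC]; exists (maxn n m) => c c' h [Bc Cc]; split.
  by apply: dB Bc => i ni; apply: h; rewrite leq_max ni.
by apply: dC Cc => i ni; apply: h; rewrite leq_max ni orbT.
Qed.

Section bits_measure_eq.
Context (R : realType).

Lemma measure_depends_split (m : probability bits R) s A n : depends_below n A ->
  m (cylinder s `&` A) =
  (m (cylinder (true :: s) `&` A) + m (cylinder (false :: s) `&` A))%E.
Proof.
move=> dA; rewrite {1}cylinder_cons setIUl measureU//.
- by apply: measurableI; [exact: measurable_cylinder|exact: measurable_depends dA].
- by apply: measurableI; [exact: measurable_cylinder|exact: measurable_depends dA].
- by rewrite setIACA cylinder_cons_disj set0I.
Qed.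

(** Finite additivity carries the equality from cylinders to all sets that read finitely many bits,
    a generating class closed under intersection. *)
Lemma bits_measure_eq (m1 m2 : probability bits R) :
  (forall s, m1 (cylinder s) = m2 (cylinder s)) ->
  forall A, measurable A -> m1 A = m2 A.
Proof.
move=> e A mA.
apply: (@measure_unique _ R bits [set A | exists n, depends_below n A] (fun=>
  setT)) => //.
- exact: bits_measurableE.
- exact: setI_closed_depends.
- by exists 0%N.
- by rewrite bigcup_const//; exists 0%N.
- move=> B [n dB]; apply: (@depends_ind (fun B => m1 B = m2 B) _ _ dB) => //.
    by rewrite !measure0.
  move=> s h1 h2.
  by rewrite (measure_depends_split m1 s dB) (measure_depends_split m2 s dB) h1 h2.
- by move=> _; apply: (le_lt_trans (probability_le1 m1 measurableT)); rewrite ltry.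
Qed.

End bits_measure_eq.

(** * Probabilities with prescribed masses of cylinders *)

Section quantile.
Context (R : realType).

Definition additive_weights (w : seq bool -> R) :=
  [/\ w [::] = 1, forall s, 0 <= w s &
      forall s, w s = w (true :: s) + w (false :: s)].

Variable w : seq bool -> R.
Hypothesis aw : additive_weights w.

(* The interval [left_end s, left_end s + w s) is the set of the numbers of
   [0, 1) whose [quantile] starts with [s]. *)
Fixpoint left_end (s : seq bool) : R :=
  if s is b :: s' then left_end s' + (if b then w (false :: s') else 0) else 0.

Fixpoint quantile_prefix (u : R) n : seq bool :=
  if n is n'.+1 then
    (left_end (true :: quantile_prefix u n') <= u) :: quantile_prefix u n'
  else [::].

(** The inverse distribution function for the lexicographic order with [false] first: the next bit
    tells which of the two subintervals of the current prefix contains [u]. *)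
Definition quantile (u : measurableTypeR R) : bits :=
  fun n => left_end (true :: quantile_prefix u n) <= u.

Lemma prefix_rev_quantile u n : prefix_rev (quantile u) n = quantile_prefix u n.
Proof. by elim: n => //= n ->. Qed.

Lemma measurable_quantile : measurable_fun setT quantile.
Proof.
have mp n s : measurable [set u : measurableTypeR R | quantile_prefix u n = s].
  elim: n s => [|n IH] [|b s] /=.
  - by rewrite (_ : mkset _ = setT)//; apply/seteqP; split.
  - by rewrite (_ : mkset _ = set0)//; apply/seteqP; split.
  - by rewrite (_ : mkset _ = set0)//; apply/seteqP; split.
  rewrite (_ : mkset _ = [set u : measurableTypeR R | quantile_prefix u n = s] `&`
      (if b then `[left_end (true :: s), +oo[%classic else `]-oo, left_end (true ::
        s)[%classic)).
    by apply: measurableI => //; case: b.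
  apply/seteqP; split => u /=.
    move=> [] <- ->; split=> //.
    by case: leP => h; rewrite /= in_itv/= ?andbT.
  move=> [-> h]; congr cons; case: b h; rewrite /= in_itv/= ?andbT//.
  by move=> h; apply/negbTE; rewrite -ltNge.
apply: measurable_fun_bits => n.
rewrite (_ : mkset _ = \bigcup_s ([set u :
  measurableTypeR R | quantile_prefix u n = s] `&`
   `[left_end (true :: s), +oo[%classic)).
  by apply: countable_bigcupT_measurable => [|s];
    [exact: countableP|exact: measurableI].
apply/seteqP; split => u /=; rewrite /quantile.
  by move=> h; exists (quantile_prefix u n) => //; split=> //=; rewrite in_itv/= h.
by move=> [s _ [/= ->]]; rewrite in_itv/= andbT.
Qed.

Lemma quantile_prefix_bounds u n : 0 <= u < 1 ->
  left_end (quantile_prefix u n) <= u <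
  left_end (quantile_prefix u n) + w (quantile_prefix u n).
Proof.
have [w1 _ wD] := aw => u01; elim: n => [|n] /=; first by rewrite w1 add0r.
set s := quantile_prefix u n => /andP[h1 h2].
have := wD s; case: (leP (left_end s + w (false :: s)) u) => /= h e; apply/andP;
  split; lra.
Qed.

Lemma quantile_prefixP u s : left_end s <= u < left_end s + w s ->
  quantile_prefix u (size s) = s.
Proof.
have [_ w0 wD] := aw; elim: s => //= b s IH /andP[h1 h2].
have -> : quantile_prefix u (size s) = s.
  apply: IH; rewrite wD; apply/andP; split.
    by apply: le_trans h1; rewrite lerDl; case: b {h2}.
  by apply: lt_le_trans h2 _; have := w0 (true :: s); case: b {h1}; lra.
congr cons; case: b h1 h2 => // _; rewrite addr0 => h2.
by apply/negbTE; rewrite -ltNge.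
Qed.

Lemma left_end_bounds s : 0 <= left_end s /\ left_end s + w s <= 1.
Proof.
have [w1 w0 wD] := aw; elim: s => [|b s [h1 h2]] /=; first by rewrite w1 add0r.
have := wD s; have := w0 (true :: s); have := w0 (false :: s).
by case: b; split; lra.
Qed.

Definition weights_probability : probability bits R :=
  push_probability measurable_quantile (uniform_prob (@ltr01 R)).

Lemma weights_probabilityE s : weights_probability (cylinder s) = (w s)%:E.
Proof.
have [w1 w0 wD] := aw; have [l0 l1] := left_end_bounds s.
rewrite push_probabilityE /= /uniform_prob integral_uniform_pdf.
rewrite (eq_integral (cst 1%E)); last first.
  move=> u /[!inE] -[_]; rewrite /= in_itv/= /uniform_pdf => ->.
  by rewrite subr0 invr1.
have mE : measurable (quantile @^-1` cylinder s `&` `[0, 1]).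
  apply: measurableI => //; rewrite -[X in measurable X]setTI.
  by apply: measurable_quantile => //; exact: measurable_cylinder.
rewrite integral_cst// mul1e.
have -> : (w s)%:E = lebesgue_measure (`[left_end s, left_end s + w s[%classic :
  set (measurableTypeR R)).
  rewrite lebesgue_measure_itv/= lte_fin; case: ifPn => [_|].
    by rewrite -EFinB; congr EFin; ring.
  by rewrite -leNgt gerDl => h; congr EFin; apply/eqP; rewrite eq_le h w0.
have e1 : lebesgue_measure ([set 1] : set (measurableTypeR R)) = 0%E.
  exact: lebesgue_measure_set1.
(* On [0, 1) the prefix of [quantile u] is [s] exactly when [u] lies in the interval of [s]. At 1
   the strict bound of [quantile_prefix_bounds] fails, so this point is set apart as a null set. *)
rewrite -[RHS](@measureU0 _ _ _ _ _ (quantile @^-1` cylinder s `&` [set 1]))//.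
- congr (_ _); apply/seteqP; split => u /=.
    move=> [cu]; rewrite in_itv/= => /andP[u0].
    rewrite le_eqVlt => /orP[/eqP u1|u1]; first by right.
    left; rewrite in_itv/=; rewrite /cylinder/= prefix_rev_quantile in cu.
    by rewrite -cu; apply: quantile_prefix_bounds; rewrite u0.
  move=> [|[cu u1]]; last by split=> //; rewrite u1 in_itv/= ler01 lexx.
  rewrite in_itv/= => h; split.
    by rewrite /cylinder/= prefix_rev_quantile; exact: quantile_prefixP.
  rewrite in_itv/=; move/andP: h => [h1 h2].
  by rewrite (le_trans l0 h1)/=; apply: ltW; exact: lt_le_trans l1.
- apply: measurableI => //; rewrite -[X in measurable X]setTI.
  by apply: measurable_quantile => //; exact: measurable_cylinder.
- apply/eqP; rewrite eq_le measure_ge0 andbT -e1 le_measure// ?inE//.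
  apply: measurableI => //; rewrite -[X in measurable X]setTI.
  by apply: measurable_quantile => //; exact: measurable_cylinder.
Qed.

End quantile.

(** * Limits of measures along an ultrafilter *)

Lemma ultra_bounded_cvg (R : realType) (U : set_system nat) (u : nat -> R) (a b : R) :
  UltraFilter U -> (forall n, a <= u n <= b) -> cvg (u @ U).
Proof.
move=> UU uab; have PU := @ultra_proper _ _ UU.
(* The image of [U] clusters at a point of the compact segment, and an ultrafilter converges to each
   of its cluster points. *)
have [|p [_ clp]] := @segment_compact R a b (u @ U) _.
  by apply: (@filterE _ U _ (u @^-1` `[a, b])) => n; rewrite /= in_itv/=; exact: uab.
apply/cvg_ex; exists p => V Vp.
have [//|UC] := in_ultra_setVsetC (u @^-1` V) UU.
by have [y [/= nVy Vy]] := clp (~` V) V UC Vp.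
Qed.

Section ultralimit.
Context (R : realType) (U : set_system nat).
Hypothesis UU : UltraFilter U.

Let PU : ProperFilter U := @ultra_proper _ _ UU.
Local Existing Instance PU.

(** The masses of each cylinder lie in [0, 1], so they converge along [U], and the limits are again
    additive weights. Countable additivity is not inherited from the [rho k]; it comes from
    [weights_probability]. *)
Lemma ultralimit_bits (rho : nat -> probability bits R) :
  exists nu : probability bits R, forall n A, depends_below n A ->
    (fun k => fine (rho k A)) @ U --> fine (nu A).
Proof.
have /choice[w cw] : forall s, exists l : R, (fun k =>
  fine (rho k (cylinder s))) @ U --> l.
  move=> s; apply/cvg_ex; apply: (@ultra_bounded_cvg R U _ 0 1) => k.
  rewrite fine_ge0//= -lee_fin fineK ?fin_num_measure//;
    last exact: measurable_cylinder.
  by apply: probability_le1; exact: measurable_cylinder.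
have cvgU (u : nat -> R) (a b : R) : u @ U --> a -> u @ U --> b -> a = b.
  by move=> h1 h2; rewrite -(cvg_lim (@Rhausdorff R) h1) -(cvg_lim (@Rhausdorff R) h2).
have aw : additive_weights w.
  split.
  - apply: (cvgU _ _ _ (cw [::])).
    rewrite (_ : cylinder _ = setT); last by apply/seteqP; split.
    rewrite (_ : (fun _ => _) = cst 1); first exact: cvg_cst.
    by apply/funext => k; rewrite probability_setT.
  - by move=> s; apply: (cvgr_to_ge (cw s)); apply: nearW => k; rewrite fine_ge0.
  - move=> s; apply: (cvgU _ _ _ (cw s)).
    rewrite (_ : (fun k => _) = (fun k => fine (rho k (cylinder (true :: s)))
      + fine (rho k (cylinder (false :: s))))).
      exact: cvgD (cw _) (cw _).
    apply/funext => k; have := @measure_depends_split R (rho k)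
      s setT 0 (fun _ _ _ _ => I).
    rewrite !setIT => ->; rewrite fineD ?fin_num_measure//; exact: measurable_cylinder.
exists (weights_probability w) => n A dA.
apply: (@depends_ind (fun A => (fun k => fine (rho k A)) @ U -->
  fine (weights_probability w A)) _ _ dA).
- rewrite measure0 (_ : (fun _ => _) = cst 0); first exact: cvg_cst.
  by apply/funext => k; rewrite measure0.
- by move=> s; rewrite weights_probabilityE.
- move=> s h1 h2; have mA := measurable_depends dA.
  have mc := measurable_cylinder.
  rewrite (measure_depends_split _ s dA) fineD ?fin_num_measure//;
    try exact: measurableI.
  under eq_fun => k.
    rewrite (measure_depends_split _ s dA) fineD ?fin_num_measure//;
      try exact: measurableI.
    over.
  exact: cvgD h1 h2.
Qed.

End ultralimit.

Section mixture.
Context d d' (A : measurableType d) (B : measurableType d') (R : realType).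
Local Open Scope ereal_scope.

(** The mixture is the join of the Giry monad, whose integration formula gives the second
    property. *)
Lemma mixture_exists (m : probability A R) (k : A -> probability B R) :
  (forall U, measurable U -> measurable_fun setT (fun a => k a U)) ->
  exists p : probability B R,
    (forall U, measurable U -> p U = \int[m]_a k a U) /\
    (forall f : B -> \bar R, measurable_fun setT f -> (forall y, 0 <= f y) ->
       \int[p]_y f y = \int[m]_a \int[k a]_y f y).
Proof.
move=> mk.
have mgk : measurable_fun setT (k : A -> giry B R).
  exact: measurable_giry_codensity.
pose j : giry B R := giry_join (giry_map mgk (m : giry A R)).
have jE U : measurable U -> j U = \int[m]_a k a U.
  move=> mU; rewrite /j /= /giry_join/= /giry_int.
  by rewrite ge0_integral_pushforward//; exact: measurable_giry_ev.
(* The join is typed as a subprobability only, so its mass is computed before it is packed as a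
   probability. *)
have j1 : j setT = 1.
  rewrite jE// (eq_integral (cst 1)) ?integral_cst//= ?mul1e ?probability_setT//.
  by move=> a _; rewrite probability_setT.
pose pm := Measure_isProbability.Build _ _ _ j j1.
pose p : probability B R := HB.pack (SubProbability.sort j) pm.
exists p; split=> [U mU|f mf f0]; first exact: jE.
have := @giry_int_join _ B R (giry_map mgk (m : giry A R)) f mf f0.
rewrite /giry_int => e; rewrite [LHS]e ge0_integral_pushforward//.
  exact: measurable_giry_int.
by move=> x _; apply: integral_ge0.
Qed.

End mixture.

(** * Polish spaces as retracts of the Cantor space *)

Lemma dense_sequence_exists (T : ptopologicalType) (D : set T) :
  countable D -> dense D -> exists e : nat -> T, dense (range e).
Proof.
move=> /pfcard_geP cD dD; case: cD => [D0|[f]].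
  have [y [_]] := dD setT (ex_intro _ point I) openT.
  by rewrite D0.
exists f; move=> O O0 oO; have [y [Oy Dy]] := dD O O0 oO.
exists y; split=> //; have [n _ <-] := (@surj _ _ _ _ f) y Dy.
by exists n.
Qed.

Section coding.
Context (R : realType) (X : completePseudoMetricType R).
Hypothesis hX : hausdorff_space X.
Variable e : nat -> X.
Hypothesis de : dense (range e).

Definition radius n : R := 2^-1 ^+ n.

Lemma radius_gt0 n : 0 < radius n.
Proof. by rewrite exprn_gt0// invr_gt0. Qed.

Lemma radiusS n : radius n = radius n.+1 + radius n.+1.
Proof. by rewrite /radius exprS; field. Qed.

Lemma radius_small (a b : R) : 0 < b -> exists n, a * radius n < b.
Proof.
move=> b0; have : (fun n => a * radius n) @ \oo --> (a * 0 : R).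
  apply: cvgMr; apply: cvg_expr.
  by rewrite ger0_norm ?invr_ge0// invf_lt1// ltr1n.
rewrite mulr0 => /cvgr_lt /(_ _ b0) [n _ h]; exists n; exact: h n (leqnn _).
Qed.

(** The interior is taken because balls of a pseudometric structure need not be open, while a bit of
    [code] must test a Borel set. *)
Definition near_net n i : set X := (ball (e i) (radius n))°.

Lemma open_near_net n i : open (near_net n i).
Proof. exact: open_interior. Qed.

Lemma near_net_ball n i x : near_net n i x -> ball (e i) (radius n) x.
Proof. by move=> /interior_subset. Qed.

Lemma near_net_cover n x : exists i, near_net n i x.
Proof.
have [y [xy [i _ iy]]] : exists y, (ball x (radius n.+1))° y /\ range e y.
  apply: de; last exact: open_interior.
  exists x; have [] := open_nbhs_ball x (PosNum (radius_gt0 n.+1)).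
  by [].
exists i; rewrite /near_net /interior; apply/nbhs_ballP.
exists (radius n.+1); first exact: radius_gt0.
move=> z xz; rewrite iy radiusS; apply: ball_triangle xz.
by apply: ball_sym; exact: interior_subset xy.
Qed.

(** All memberships are recorded, without choosing one ball at each scale, so each bit is the
    indicator of an open set. The choice is left to [digit]. *)
Definition code (x : borel X) : bits := fun k =>
  if unpickle k is Some (n, i) then `[< near_net n i x >] else false.

Lemma measurable_code : measurable_fun setT code.
Proof.
apply: measurable_fun_bits => k; rewrite /code.
case: unpickle => [[n i]|].
  rewrite (_ : mkset _ = near_net n i); last first.
    by apply/seteqP; split => x /= /asboolP.
  by apply: sub_sigma_algebra; exact: open_near_net.
by rewrite (_ : mkset _ = set0)//; apply/seteqP; split.
Qed.

(* [i] is the first point of the dense sequence that, according to [c], lies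
   within [radius n] of the coded point. *)
Definition digit (c : bits) (n i : nat) : bool :=
  c (pickle (n, i)) && all (fun j => ~~ c (pickle (n, j))) (iota 0 i).

Lemma digit_uniq (c : bits) (n i j : nat) : digit c n i -> digit c n j -> i = j.
Proof.
wlog ij : i j / (i <= j)%N.
  by move=> H di dj; case: (leqP i j) => [|/ltnW] h; [|symmetry]; exact: H.
move=> /andP[ci _] /andP[_ /allP cj]; apply/eqP; rewrite eqn_leq ij/= leqNgt.
by apply/negP => ji; have := cj i; rewrite mem_iota/= add0n ji ci => /(_ isT).
Qed.

Lemma digit_exists (c : bits) (n i : nat) : c (pickle (n, i)) ->
  exists2 j, (j <= i)%N & digit c n j.
Proof.
move=> ci; have ex : exists j : nat, c (pickle (n, j)) by exists i.
exists (ex_minn ex); case: ex_minnP => j cj h; first exact: h.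
rewrite /digit cj/=; apply/allP => k; rewrite mem_iota/= add0n => kj.
by apply/negP => /h; rewrite leqNgt kj.
Qed.

Lemma digit_code x n i : digit (code x) n i -> near_net n i x.
Proof. by rewrite /digit /code pickleK => /andP[/asboolP]. Qed.

Lemma depends_digit n i : exists N, depends_below N [set c : bits | digit c n i].
Proof.
exists (\max_(j < i.+1) (pickle (n, nat_of_ord j))).+1 => c c' cc' /=.
have E (j : nat) : (j <= i)%N -> c (pickle (n, j)) = c' (pickle (n, j)).
  move=> ji; apply: cc'; rewrite ltnS.
  exact: (@leq_bigmax _ (fun j : 'I_i.+1 => pickle (n, nat_of_ord j))
    (Ordinal (ji : j < i.+1)%N)).
rewrite /digit E// => /andP[-> /allP h] /=; apply/allP => j jI.
rewrite -E ?h//; move: jI; rewrite mem_iota/= add0n; exact: ltnW.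
Qed.

Lemma measurable_digit n i : measurable [set c : bits | digit c n i].
Proof. by have [N] := depends_digit n i; exact: measurable_depends. Qed.

(** The 2 is what true codes satisfy: two consecutive balls around a common point have centres
    within [radius n + radius n.+1], which is below [2 * radius n]. These bounds are summable, so
    the centres form a Cauchy sequence. *)
Definition coherent (c : bits) :=
  (forall n, exists i, digit c n i) /\
  (forall n i j, digit c n i -> digit c n.+1 j -> ball (e i) (2 * radius n) (e j)).

Lemma coherent_code x : coherent (code x).
Proof.
split=> [n|n i j /digit_code/near_net_ball di /digit_code/near_net_ball dj].
  have [i xi] := near_net_cover n x.
  have [|j _ dj] := @digit_exists (code x) n i; last by exists j.
  by rewrite /code pickleK; exact/asboolP.
apply: (@le_ball _ _ _ (radius n + radius n.+1)).
  by have := radius_gt0 n.+1; rewrite (radiusS n) mulr2n mulrDl !mul1r; lra.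
exact: ball_triangle di (ball_sym dj).
Qed.

Lemma measurable_coherent : measurable [set c | coherent c].
Proof.
rewrite (_ : mkset _ = (\bigcap_n \bigcup_i [set c : bits | digit c n i]) `&`
  (\bigcap_n \bigcap_i \bigcap_j [set c : bits | digit c n i -> digit c n.+1 j ->
      ball (e i) (2 * radius n) (e j)])).
  apply: measurableI.
    by apply: bigcapT_measurable => n; apply: bigcupT_measurable => i;
      exact: measurable_digit.
  apply: bigcapT_measurable => n; apply: bigcapT_measurable => i.
  apply: bigcapT_measurable => j.
  have [b|b] := pselect (ball (e i) (2 * radius n) (e j)).
    rewrite (_ : mkset _ = setT); first exact: measurableT.
    by apply/seteqP; split=> // c _ _ _.
  rewrite (_ : mkset _ = ~` ([set c : bits | digit c n i] `&` [set c :
    bits | digit c n.+1 j])).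
    by apply: measurableC; apply: measurableI; exact: measurable_digit.
  apply/seteqP; split=> c /=; first by move=> h [d1 d2]; exact: b (h d1 d2).
  by move=> h d1 d2; case: h.
apply/seteqP; split => c /=.
  move=> [h1 h2]; split=> [n _|n _ i _ j _]; last exact: h2.
  by have [i di] := h1 n; exists i.
move=> [h1 h2]; split=> [n|n i j]; last exact: h2.
by have [i _ di] := h1 n I; exists i.
Qed.

(** From scale [n] on, the centres move by at most the geometric sum 2 [radius n] + 2 [radius n.+1]
    + ... = 4 [radius n]; passing to the limit costs one more [radius n], whence the 5. *)
Lemma coherent_limit c : coherent c ->
  exists x, forall n i, digit c n i -> ball (e i) (5 * radius n) x.
Proof.
move=> [/choice[s ds] cc].
have b1 n k : ball (e (s n)) (4 * radius n) (e (s (n + k)%N)).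
  elim: k n => [|k IH] n.
    by rewrite addn0; apply: ballxx; rewrite mulr_gt0 ?radius_gt0.
  rewrite addnS -addSn.
  have -> : 4 * radius n = 2 * radius n + 4 * radius n.+1 by rewrite (radiusS n); ring.
  exact: ball_triangle (cc _ _ _ (ds n) (ds n.+1)) (IH n.+1).
have cs : cvg ((e \o s) @ \oo).
  apply: cauchy_cvg; apply: cauchy_exP => eps eps0.
  have [n n4] := radius_small 4 eps0; exists (e (s n)); exists n => //= m nm.
  apply: (@le_ball _ _ _ (4 * radius n)); first exact: ltW.
  by rewrite -(subnKC nm); exact: b1.
exists (lim ((e \o s) @ \oo)) => n i di.
rewrite (digit_uniq di (ds n)).
have : \forall m \near \oo, ball (lim ((e \o s) @ \oo)) (radius n) (e (s m)).
  by apply: cs; apply/nbhs_ballP; exists (radius n) => //; exact: radius_gt0.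
move=> [m _ /(_ (n + m)%N)/= h].
have -> : 5 * radius n = 4 * radius n + radius n by ring.
by apply: ball_triangle (b1 n m) (ball_sym (h _)); rewrite leq_addl.
Qed.

Lemma ball_eq (x y : X) : (forall n, ball x (10 * radius n) y) -> x = y.
Proof.
move=> b; apply: contrapT => xy.
move: hX; rewrite ball_hausdorff => /(_ x y (introN eqP xy))[[r1 r2] /= /eqP r12].
have [n n10] := radius_small 10 (gt0 r1).
suff : (ball x r1%:num `&` ball y r2%:num) y by rewrite r12.
split; last exact: ballxx.
by apply: le_ball (b n); exact: ltW.
Qed.

Definition decode (c : bits) : borel X :=
  if pselect (coherent c) is left h then projT1 (cid (coherent_limit h)) else point.

Lemma decodeP c n i : coherent c -> digit c n i -> ball (e i) (5 * radius n) (decode c).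
Proof.
rewrite /decode => cc; case: pselect => // h; case: cid => x /= hx; exact: hx.
Qed.

Lemma codeK x : decode (code x) = x.
Proof.
apply: ball_eq => n; have [cv _] := coherent_code x; have [i di] := cv n.
apply: (@le_ball _ _ _ (5 * radius n + radius n)); first by have := radius_gt0 n; lra.
apply: (@ball_triangle _ _ (e i)).
  by apply: ball_sym; apply: decodeP => //; exact: coherent_code.
exact/near_net_ball/digit_code.
Qed.

(** On coherent sequences, [decode c] lies in an open [U] exactly when some digit of [c] names a
    ball of radius [5 * radius n] inside [U], a countable union of digit events. Elsewhere [decode]
    is constantly [point]. *)
Lemma measurable_decode : measurable_fun setT decode.
Proof.
apply: (@measurability _ _ bits (borel X) setT decode (@open X)) => //.
move=> _ [U oU <-]; rewrite setTI.
have mV := measurable_coherent.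
rewrite (_ : decode @^-1` U =
  ([set c | coherent c] `&` \bigcup_n \bigcup_(i in [set i | ball (e i)
    (5 * radius n) `<=` U])
     [set c : bits | digit c n i]) `|`
  (~` [set c | coherent c] `&` (if `[< U point >] then setT else set0))).
  apply: measurableU; apply: measurableI => //.
  - apply: bigcupT_measurable => n; apply: bigcup_measurable => i _;
      exact: measurable_digit.
  - exact: measurableC.
  - by case: ifP.
apply/seteqP; split => c /=.
  move=> Uc; have [h|h] := pselect (coherent c); [left|right]; split=> //.
    have [r /= r0 rU] : nbhs_ball (decode c) U by apply/nbhs_ballP;
      exact: open_nbhs_nbhs.
    have [n n10] := radius_small 10 r0; have [i di] := h.1 n.
    exists n => //; exists i => //= y iy; apply: rU.
    apply: (@le_ball _ _ _ (10 * radius n)); first exact: ltW.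
    have -> : 10 * radius n = 5 * radius n + 5 * radius n by ring.
    by apply: ball_triangle iy; apply: ball_sym; exact: decodeP.
  by move: Uc; rewrite /decode; case: pselect => // _ Up; rewrite asboolT.
move=> [[h [n _ [i /= iU di]]]|[h]]; first exact/iU/decodeP.
by rewrite /decode; case: pselect => // _; case: asboolP.
Qed.

End coding.

(** * Borel sets of the weak topology *)

Section weak_borel.
Context (R : realType) (X : completePseudoMetricType R).

Lemma lsc_measurable (T : ptopologicalType) (f : T -> R) :
  (forall a, open [set x | a < f x]) -> measurable_fun setT (f : borel T -> R).
Proof.
move=> of_; apply: (measurability (@RGenOInfty.G R));
  first exact: RGenOInfty.measurableE.
move=> _ [_ [a ->] <-]; rewrite setTI; apply: sub_sigma_algebra.
rewrite (_ : _ @^-1` _ = [set x | a < f x]) /=; first exact: of_.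
by apply/seteqP; split => x /=; rewrite in_itv/= andbT.
Qed.

Lemma continuous_lsc (T : topologicalType) (f : T -> R) : continuous f ->
  forall a, open [set x | a < f x].
Proof.
by move=> cf a; apply: (open_comp (f := f) (D := [set y | a < y])) => //;
  exact: open_gt.
Qed.

Lemma indic_lsc (T : topologicalType) (U : set T) a : open U ->
  open [set x | a < \1_U x :> R].
Proof.
move=> oU.
have [a0|a0] := ltP a 0.
  rewrite (_ : mkset _ = setT); first exact: openT.
  by apply/seteqP; split => // x _; apply: lt_le_trans a0 _.
have [a1|a1] := ltP a 1.
  rewrite (_ : mkset _ = U)//; apply/seteqP; split => x /=; last by move=> Ux;
    rewrite indicE mem_set.
  by rewrite indicE; case: (boolP (x \in U)) => [/set_mem//|_]; rewrite ltNge a0.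
rewrite (_ : mkset _ = set0); first exact: open0.
apply/seteqP; split => // x /=; rewrite indicE ltNge; case: (x \in U); rewrite ?a1//.
by rewrite (le_trans _ a1).
Qed.

Lemma borel_continuous_measurable (T : ptopologicalType) (f : T -> R) :
  continuous f -> measurable_fun setT (f : borel T -> R).
Proof. by move=> cf; apply: lsc_measurable; exact: continuous_lsc. Qed.

Variable e : nat -> X.
Hypothesis de : dense (range e).

(** A Urysohn function: by the triangle inequality, a ball and the complement of the ball of twice
    the radius are separated by an entourage. *)
Lemma bump_exists (t : nat * nat) : exists f : X -> R, [/\ continuous f,
  forall x, 0 <= f x <= 1,
  forall x, ball (e t.2) (radius R t.1) x -> f x = 1 &
  forall x, ~ ball (e t.2) (2 * radius R t.1) x -> f x = 0].
Proof.
have r0 := radius_gt0 R t.1.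
have : uniform_separator (~` ball (e t.2) (2 * radius R t.1)) (ball (e t.2)
  (radius R t.1)).
  apply: uniform_separatorW; exists [set xy | ball xy.1 (radius R t.1) xy.2].
    by rewrite -entourage_ballE; exists (radius R t.1).
  apply/seteqP; split => // -[x y] /= [[nx by_] xy]; apply: nx.
  by rewrite mulr_natl mulr2n; apply: ball_triangle by_ (ball_sym xy).
move=> /(@uniform_separatorP _ R)[f [cf f01 f0 f1]]; exists f; split=> //.
- by move=> x; have := f01 (f x) (ex_intro2 _ _ x I erefl); rewrite /= in_itv/=.
- by move=> x bx; apply: f1; exists x.
- by move=> x bx; apply: f0; exists x.
Qed.

Definition bump t : X -> R := projT1 (cid (bump_exists t)).

Lemma bump_continuous t : continuous (bump t).
Proof. by rewrite /bump; case: cid => f []. Qed.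

Lemma bump_itv t x : 0 <= bump t x <= 1.
Proof. by rewrite /bump; case: cid => f []. Qed.

Lemma bump1 n i x : ball (e i) (radius R n) x -> bump (n, i) x = 1.
Proof. by rewrite /bump; case: cid => f [] /= _ _ h _; exact: h. Qed.

Lemma bump0 n i x : ~ ball (e i) (2 * radius R n) x -> bump (n, i) x = 0.
Proof. by rewrite /bump; case: cid => f [] /= _ _ _; exact. Qed.

(** A countable family of bounded continuous functions that replaces the uncountable family of test
    functions: every nonnegative lower semicontinuous function is an increasing limit of its
    members. *)
Definition lattice_fun (l : seq (rat * (nat * nat))) : X -> R :=
  foldr (fun t g x => Num.max (ratr t.1 * bump t.2 x) (g x)) (cst 0) l.

Lemma lattice_fun_ge0 l x : 0 <= lattice_fun l x.
Proof. by elim: l => //= t l IH; rewrite le_max IH orbT. Qed.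

Lemma lattice_fun_continuous l : continuous (lattice_fun l).
Proof.
elim: l => [|t l IH] /= x; first exact: cvg_cst.
apply: (@continuous_max _ _ (fun x => ratr t.1 * bump t.2 x) (lattice_fun l)) ;
  last exact: IH.
by apply: cvgMr; exact: bump_continuous.
Qed.

Lemma lattice_fun_bounded l : exists M, forall x, lattice_fun l x <= M.
Proof.
elim: l => [|t l [M hM]] /=; first by exists 0.
exists (Num.max `|ratr t.1| M) => x; rewrite ge_max !le_max hM orbT andbT.
have /andP[b0 b1] := bump_itv t.2 x; apply/orP; left.
apply: le_trans (ler_norm _) _; rewrite normrM (ger0_norm b0).
by rewrite ler_piMr.
Qed.

Section lsc_approx.
Variable phi : X -> R.
Hypothesis phi0 : forall x, 0 <= phi x.
Hypothesis lsc : forall a, open [set x | a < phi x].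

Let fits (t : rat * (nat * nat)) := `[< forall x, ratr t.1 * bump t.2 x <= phi x >].

(** Collects every scaled bump lying below [phi] whose code is less than [n]; the lists only grow,
    which makes their maxima monotone in [n]. *)
Fixpoint lsc_list n : seq (rat * (nat * nat)) :=
  if n is n'.+1 then
    if unpickle n' is Some t then
      if fits t then t :: lsc_list n' else lsc_list n'
    else lsc_list n'
  else [::].

Let lsc_listS n : lsc_list n.+1 =
  if unpickle n is Some t then if fits t then t :: lsc_list n else lsc_list n
  else lsc_list n.
Proof. by []. Qed.

Lemma lsc_list_le n x : lattice_fun (lsc_list n) x <= phi x.
Proof.
elim: n => //= n IH; case: unpickle => // t; rewrite /fits; case: asboolP => //= ft.
by rewrite ge_max ft.
Qed.

Lemma lsc_list_nd x : {homo (fun n => lattice_fun (lsc_list n) x) :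
  m n / (m <= n)%N >-> m <= n}.
Proof.
apply: homo_leq => //; first exact: le_trans.
move=> n /=; case: unpickle => // t; rewrite /fits; case: asboolP => //= ft.
by rewrite le_max lexx orbT.
Qed.

Lemma lsc_list_approx x a : a < phi x -> exists n, a <= lattice_fun (lsc_list n) x.
Proof.
move=> ax; have [a0|a0] := leP a 0.
  by exists 0%N.
have [q /andP[aq qx]] := rat_in_itvoo ax.
have q0 : (0 : R) <= ratr q by apply: ltW; exact: lt_trans aq.
have [r /= r0 rU] : nbhs_ball x [set y | ratr q < phi y].
  by apply/nbhs_ballP; apply: open_nbhs_nbhs; split=> //.
(* Where the bump is nonzero, a point is within [2 * radius R n] of [e i], itself within
   [radius R n] of [x]: hence the 3. *)
have [n n4] := radius_small 3 r0.
have [i xi] := near_net_cover de n x.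
have [k kK] : exists k, unpickle k = Some (q, (n, i)).
  by exists (pickle (q, (n, i))); rewrite pickleK.
exists k.+1; rewrite lsc_listS kK /fits.
case: asboolP => [_|[]] /=.
  by rewrite bump1 ?mulr1 ?le_max ?(ltW aq)//; exact: near_net_ball.
move=> y; have /andP[b0 b1] := bump_itv (n, i) y.
have [by_|/bump0->] := pselect (ball (e i) (2 * radius R n) y); last by rewrite mulr0.
apply: (@le_trans _ _ (ratr q)); first by rewrite ler_piMr.
apply: ltW; apply: rU; apply: (@le_ball _ _ _ (3 * radius R n)); first exact: ltW.
have -> : 3 * radius R n = radius R n + 2 * radius R n by ring.
by apply: ball_triangle by_; apply: ball_sym; exact: near_net_ball.
Qed.

Lemma lsc_list_cvg x : (fun n => (lattice_fun (lsc_list n) x)%:E) @ \oo --> (phi x)%:E.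
Proof.
apply: cvg_EFin; first exact: nearW.
apply/cvgrPdist_le => eps eps0.
have [n hn] : exists n, phi x - eps <= lattice_fun (lsc_list n) x.
  by apply: lsc_list_approx; rewrite ltrBlDr ltrDl.
exists n => // m /= nm; rewrite ger0_norm ?subr_ge0 ?lsc_list_le//.
by rewrite lerBlDr addrC -lerBlDr; apply: le_trans hn _; exact: lsc_list_nd.
Qed.

Lemma integral_lsc_list (p : probability (borel X) R) :
  (fun n => \int[p]_x (lattice_fun (lsc_list n) x)%:E)%E @ \oo -->
  (\int[p]_x (phi x)%:E)%E.
Proof.
have -> : (\int[p]_x (phi x)%:E = \int[p]_x limn (fun n =>
  (lattice_fun (lsc_list n) x)%:E))%E.
  by apply: eq_integral => x _; apply/esym/cvg_lim => //; exact: lsc_list_cvg.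
apply: cvg_monotone_convergence => //.
- move=> n; apply/measurable_EFinP; apply: borel_continuous_measurable.
  exact: lattice_fun_continuous.
- by move=> n x _; rewrite lee_fin lattice_fun_ge0.
- by move=> x _ m n mn; rewrite lee_fin; exact: lsc_list_nd.
Qed.

End lsc_approx.

(** The indicator of an open set is lower semicontinuous, so monotone convergence along [lsc_list]
    gives equality on open sets, which form a generating class closed under intersection. *)
Lemma probability_borel_eq (p q : probability (borel X) R) :
  (forall l, \int[p]_x (lattice_fun l x)%:E = \int[q]_x (lattice_fun l x)%:E)%E ->
  forall A : set (borel X), measurable A -> p A = q A.
Proof.
move=> pq A mA.
apply: (@measure_unique _ R (borel X) (@open X) (fun=> setT)) => //.
- by move=> B C; exact: openI.
- by move=> _; exact: openT.
- by rewrite bigcup_const//; exists 0%N.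
- move=> U oU.
  have l0 (x : X) : 0 <= \1_U x :> R by [].
  have lsc a : open [set x : X | a < \1_U x :> R]. exact: indic_lsc.
  have mU : measurable (U : set (borel X)) by exact: sub_sigma_algebra.
  have hp := @integral_lsc_list _ l0 lsc p; have hq := @integral_lsc_list _ l0 lsc q.
  rewrite !integral_indic// !setIT in hp hq.
  rewrite -(cvg_lim _ hp)// -(cvg_lim _ hq)//; congr (lim (_ @ \oo)).
  by apply/funext => n; rewrite pq.
- by move=> _; apply: (le_lt_trans (probability_le1 p measurableT)); rewrite ltry.
Qed.

End weak_borel.

(** * Measurability of maps into and out of the space of probabilities *)

Section weak_measurability.
Context (R : realType) (X : completePseudoMetricType R).

Lemma weak_integral_continuous (f : X -> R) : continuous f -> bounded_fun f ->
  continuous (fun p : wprobability X R => \int[(p : probability (borel X) R)]_x f x).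
Proof.
move=> cf bf p.
pose g : bounded_continuous X R := exist _ f (conj cf bf).
apply: (@continuous_comp _ _ _ (@weak_eval X R) (proj g)).
  exact: initial_continuous.
exact: proj_continuous.
Qed.

Variable e : nat -> X.
Hypothesis de : dense (range e).

Lemma lattice_fun_bounded_fun l : bounded_fun (lattice_fun e l).
Proof.
have [M hM] := lattice_fun_bounded e l.
exists M; split; first exact: num_real.
move=> N MN x _ /=; rewrite ger0_norm ?lattice_fun_ge0//.
exact: le_trans (hM x) (ltW MN).
Qed.

Lemma integrable_lattice_fun l (p : probability (borel X) R) :
  p.-integrable setT (EFin \o lattice_fun e l).
Proof.
apply: measurable_bounded_integrable => //.
- by rewrite (le_lt_trans (probability_le1 p measurableT))// ltry.
- by apply: borel_continuous_measurable; exact: lattice_fun_continuous.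
- exact: lattice_fun_bounded_fun.
Qed.

Lemma integral_lattice_fun l (p : probability (borel X) R) :
  (\int[p]_x (lattice_fun e l x)%:E = (\int[p]_x lattice_fun e l x)%:E)%E.
Proof.
rewrite /Rintegral fineK//.
exact: (integrable_fin_num measurableT (integrable_lattice_fun l p)).
Qed.

(** For an open set the evaluation is a limit of weakly continuous integrals, along lists chosen
    independently of [p]. A Dynkin argument extends this to Borel sets. *)
Lemma wprobability_eval_measurable (A : set (borel X)) : measurable A ->
  measurable_fun setT (fun p : borel (wprobability X R) =>
    (p : probability (borel X) R) A).
Proof.
move=> mA.
pose Q (A : set (borel X)) := measurable_fun setT (fun p : borel (wprobability X R)
  => (p : probability (borel X) R) A).
apply: (@dynkin_induction _ (borel X) (@open X) Q) => //.
- by move=> B C; exact: openI.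
- rewrite /Q; under eq_fun do rewrite probability_setT; exact: measurable_cst.
- move=> U oU.
  have mU : measurable (U : set (borel X)) by exact: sub_sigma_algebra.
  have [L hL] : exists L : nat -> seq (rat * (nat * nat)), forall p :
    probability (borel X) R,
      (fun n => \int[p]_x (lattice_fun e (L n) x)%:E)%E @ \oo --> p U.
    exists (lsc_list e \1_U) => p.
    have := @integral_lsc_list R X e de (\1_U : X -> R) (fun=> ler0n _ _) (fun a =>
      indic_lsc a oU) p.
    by rewrite integral_indic// setIT.
  apply: (emeasurable_fun_cvg (fun n (p : borel (wprobability X R)) =>
    \int[(p : probability (borel X) R)]_x (lattice_fun e (L n) x)%:E)%E) =>
      [n|p _]; last exact: hL.
  under eq_fun do rewrite integral_lattice_fun.
  apply/measurable_EFinP; apply: borel_continuous_measurable.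
  apply: weak_integral_continuous; first exact: lattice_fun_continuous.
  exact: lattice_fun_bounded_fun.
- move=> B mB QB; rewrite /Q.
  have -> : (fun p : borel (wprobability X R) => (p : probability (borel X) R) (~` B)) =
     (fun p : borel (wprobability X R) => 1 - (p : probability (borel X) R) B)%E.
    by apply/funext => p; rewrite probability_setC.
  exact: emeasurable_funB.
- move=> F mF tF QF; rewrite /Q.
  have -> : (fun p : borel (wprobability X R) =>
    (p : probability (borel X) R) (\bigcup_k F k)) =
     (fun p : borel (wprobability X R) => \sum_(0 <= k <oo) (p :
       probability (borel X) R) (F k))%E.
    apply/funext => p; apply/esym/cvg_lim => //.
    exact: measure_semi_sigma_additive (bigcupT_measurable _ mF).
  by apply: ge0_emeasurable_sum => // k _; exact: QF.
Qed.

Definition weak_box (K : seq (seq (rat * (nat * nat)) * rat)) :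
  set (wprobability X R) :=
  [set p | forall t, t \in K -> ratr t.2 < \int[(p : probability (borel X)
    R)]_x lattice_fun e t.1 x].

(* Applied to [f + M] and [M - f], this makes the countably many sets
   [weak_box K] a base of the weak topology. *)
Lemma weak_box_lsc (f : X -> R) (p : probability (borel X) R) eps : 0 < eps ->
  (forall x, 0 <= f x) -> continuous f -> bounded_fun f ->
  exists K, weak_box K (p : wprobability X R) /\
    (forall q : probability (borel X) R, weak_box K (q : wprobability X R) ->
       \int[p]_x f x - eps < \int[q]_x f x).
Proof.
move=> eps0 f0 cf bf.
have mf : measurable_fun setT (f : borel X -> R) by exact: borel_continuous_measurable.
have inf_ (q : probability (borel X) R) : q.-integrable setT (EFin \o f).
  apply: measurable_bounded_integrable => //.
  by rewrite (le_lt_trans (probability_le1 q measurableT))// ltry.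
have Ef (q : probability (borel X) R) : (\int[q]_x (f x)%:E = (\int[q]_x f x)%:E)%E.
  by rewrite /Rintegral fineK//; exact: (integrable_fin_num measurableT (inf_ q)).
have lsc := @continuous_lsc R X f cf.
have h := @integral_lsc_list R X e de f f0 lsc p.
rewrite Ef in h; have := h.
move=> /fine_cvgP[_ /cvgr_gt /(_ (\int[p]_x f x - eps))].
rewrite /= ltrBlDr ltrDl => /(_ eps0)[n _ /(_ n (leqnn _))/= hn].
have /rat_in_itvoo[r /andP[r1 r2]] := hn.
exists [:: (lsc_list e f n, r)]; split.
  by move=> t; rewrite inE => /eqP -> /=.
move=> q /(_ _ (mem_head _ _))/= rq.
apply: (lt_le_trans (lt_trans r1 rq)); apply: le_Rintegral => //.
- exact: integrable_lattice_fun.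
- exact: inf_.
- by move=> x _; exact: lsc_list_le.
Qed.

(** The boxes around [p] generate a filter. The topology being initial, it is enough that
    [weak_eval] converges along this filter in the product topology, that is, one test function at a
    time. *)
Lemma weak_box_base (O : set (wprobability X R)) (p : wprobability X R) :
  open O -> O p -> exists K, weak_box K p /\ weak_box K `<=` O.
Proof.
move=> [B oB <-] Bp.
pose F := filter_from [set K | weak_box K p] weak_box.
have FF : Filter F.
  apply: filter_from_filter.
    by exists [::].
  move=> K1 K2 h1 h2; exists (K1 ++ K2).
    by move=> t; rewrite mem_cat => /orP[]; [exact: h1|exact: h2].
  move=> q h; split=> t tK; apply: h; rewrite mem_cat tK ?orbT//.
suff H : (@weak_eval X R @ F) --> (weak_eval p : prod_topology (fun _ :
  bounded_continuous X R => R)).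
  have /H [K Kp KB] : nbhs (weak_eval p) B by exact: open_nbhs_nbhs.
  by exists K.
apply/cvg_sup => -[f [cf bf]] A; rewrite nbhsE => -[A' [[V oV <-] Vp] VA].
have : nbhs (weak_eval p (exist _ f (conj cf bf))) V by exact: open_nbhs_nbhs.
move=> /nbhs_ballP[eps /= eps0 epsV].
have [M [Mr hM]] := bf.
pose M1 := `|M| + 1.
have fM x : `|f x| <= M1.
  by apply: hM => //; rewrite (le_lt_trans (ler_norm _))// ltrDl.
have cst1 c (q : probability (borel X) R) : \int[q]_x c = c.
  by rewrite /Rintegral integral_probability_cst.
have M0 : 0 <= M1 by rewrite addr_ge0.
have bcst c : bounded_fun (fun _ : X => c : R).
  by exists `|c|; split; [exact: num_real|move=> N cN x _ /=; exact: ltW].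
have inF (q : probability (borel X) R) : q.-integrable setT (EFin \o f).
  apply: measurable_bounded_integrable => //; last exact: borel_continuous_measurable.
  by rewrite (le_lt_trans (probability_le1 q measurableT))// ltry.
have inC c (q : probability (borel X) R) : q.-integrable setT (EFin \o (fun=> c)).
  apply: measurable_bounded_integrable => //; last exact: bcst.
  by rewrite (le_lt_trans (probability_le1 q measurableT))// ltry.
have eD (q : probability (borel X) R) : \int[q]_x (M1 + f x) = M1 + \int[q]_x f x.
  by rewrite (@RintegralD _ (borel X) R q setT (fun=>
    M1) f measurableT (inC M1 q) (inF q)) cst1.
have eB (q : probability (borel X) R) : \int[q]_x (M1 - f x) = M1 - \int[q]_x f x.
  by rewrite (@RintegralB _ (borel X) R q setT (fun=>
    M1) f measurableT (inC M1 q) (inF q)) cst1.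
have [K1 [K1p h1]] : exists K, weak_box K p /\
    (forall q : wprobability X R, weak_box K q ->
      \int[(p : probability (borel X) R)]_x f x - eps < \int[(q :
        probability (borel X) R)]_x f x).
  have [|||K [Kp h]] := @weak_box_lsc (fun x => M1 + f x) p eps eps0.
  - by move=> x; have := fM x; rewrite ler_norml => /andP[+ _]; lra.
  - by move=> x; apply: cvgD; [exact: cvg_cst|exact: cf].
  - exact: bounded_funD.
  exists K; split; first exact: Kp.
  by move=> q' /h; rewrite !eD; lra.
have [K2 [K2p h2]] : exists K, weak_box K p /\
    (forall q : wprobability X R, weak_box K q ->
      \int[(q : probability (borel X) R)]_x f x < \int[(p : probability (borel X)
        R)]_x f x + eps).
  have [|||K [Kp h]] := @weak_box_lsc (fun x => M1 - f x) p eps eps0.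
  - by move=> x; have := fM x; rewrite ler_norml => /andP[_ +]; lra.
  - by move=> x; apply: cvgB; [exact: cvg_cst|exact: cf].
  - by apply: bounded_funD => //; exact: bounded_funN.
  exists K; split; first exact: Kp.
  by move=> q' /h; rewrite !eB; lra.
exists (K1 ++ K2).
  by move=> t; rewrite mem_cat => /orP[]; [exact: K1p|exact: K2p].
move=> q qK; apply: VA; apply: epsV.
rewrite /ball/= ltr_distlC /weak_eval/=; apply/andP; split.
  by apply: h1 => t tK; apply: qK; rewrite mem_cat tK.
by apply: h2 => t tK; apply: qK; rewrite mem_cat tK orbT.
Qed.

(** Open sets of the weak topology are unions of boxes, and the boxes are indexed by a countable
    type; hence measurability has to be checked on boxes only, where it is measurability of finitely
    many integrals. *)
Lemma measurable_fun_wprobability d (Z : measurableType d) (g : Z ->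
  probability (borel X) R) :
  (forall A, measurable A -> measurable_fun setT (fun z => g z A)) ->
  measurable_fun setT (g : Z -> borel (wprobability X R)).
Proof.
move=> mg.
apply: (@measurability _ _ Z (borel (wprobability X R))
  setT g (@open (wprobability X R))) => //.
move=> _ [U oU <-]; rewrite setTI.
have UE : U = \bigcup_(K in [set K | weak_box K `<=` U]) weak_box K.
  apply/seteqP; split => [p Up|p [K /= KU Kp]]; last exact: KU.
  by have [K [Kp KU]] := weak_box_base oU Up; exists K.
have mbox K : measurable (g @^-1` weak_box K).
  elim: K => [|t K IH].
    by rewrite (_ : _ @^-1` _ = setT)//; apply/seteqP; split.
  rewrite (_ : _ @^-1` _ = [set z | ratr t.2 < \int[g z]_x lattice_fun e t.1 x] `&`
    (g @^-1` weak_box K)).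
    apply: measurableI => //.
    rewrite (_ : mkset _ = (fun z =>
      \int[g z]_x (lattice_fun e t.1 x)%:E)%E @^-1` `](ratr t.2)%:E, +oo[).
      rewrite -[X in measurable X]setTI.
      apply: (measurable_fun_integral_kernel mg) => //; last exact: emeasurable_itv.
      - by move=> x; rewrite lee_fin lattice_fun_ge0.
      - apply/measurable_EFinP; apply: borel_continuous_measurable;
          exact: lattice_fun_continuous.
    by apply/seteqP; split=> z /=; rewrite in_itv/= andbT integral_lattice_fun lte_fin.
  apply/seteqP; split => z /=.
    by move=> h; split=> [|s sK]; apply: h; rewrite inE ?eqxx// sK orbT.
  by move=> [h1 h2] s; rewrite inE => /predU1P[->//|]; exact: h2.
rewrite (_ : g @^-1` U = \bigcup_K (if `[< weak_box K `<=` U >] then g @^-1`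
  weak_box K else set0)).
  by apply: countable_bigcupT_measurable => [|K]; [exact: countableP|case: ifP].
apply/seteqP; split => z /=.
  by rewrite {1}UE => -[K /= KU Kz]; exists K => //; rewrite asboolT.
by move=> [K _]; case: asboolP => // KU; exact: KU.
Qed.

End weak_measurability.

(** * Krylov-Bogoliubov theorem *)

Lemma compact_seq_cluster (T : topologicalType) (x : nat -> T) : compact [set: T] ->
  exists p : T, forall B, nbhs p B -> forall N, exists2 n, (N <= n)%N & B (x n).
Proof.
move=> cT; have [p [_ clp]] := cT (x @ \oo) _ filterT.
exists p => B Bp N.
have FA : (x @ \oo) (x @` [set n | (N <= n)%N]) by exists N => // n Nn; exists n.
by have [_ [[n /= Nn <-] Bn]] := clp _ _ FA Bp; exists n.
Qed.

Lemma ae_probability1 d (T : measurableType d) (R : realType) (m : probability T R)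
  (A : set T) : measurable A -> m A = 1%E -> {ae m, forall x, A x}.
Proof.
move=> mA mA1; exists (~` A); split => //; first exact: measurableC.
by rewrite probability_setC// mA1 subee.
Qed.

Section probability_of_measure.
Context d (T : measurableType d) (R : realType).
Variable m : {measure set T -> \bar R}.
Hypothesis m1 : m setT = 1%E.

(** The argument carries the proof of mass one inside the term, so that the probability structure
    can be attached to it. *)
Definition probability_of_measure of m setT = 1%E : set T -> \bar R := m.

Let mu := probability_of_measure m1.

Let mu0 : mu set0 = 0%E. Proof. exact: measure0. Qed.

Let mu_ge0 A : (0 <= mu A)%E. Proof. exact: measure_ge0. Qed.

Let mu_sigma_additive : semi_sigma_additive mu.
Proof. exact: measure_semi_sigma_additive. Qed.

HB.instance Definition _ := isMeasure.Build _ _ _ mu mu0 mu_ge0 mu_sigma_additive.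
HB.instance Definition _ := Measure_isProbability.Build _ _ _ mu m1.

Definition to_probability : probability T R := mu.

Lemma integral_to_probability (f : T -> \bar R) :
  (\int[to_probability]_x f x = \int[m]_x f x)%E.
Proof. by apply: eq_measure_integral. Qed.

End probability_of_measure.

(** * Limits of probabilities on a compact space, through codes *)

Section compact_coding.
Context (R : realType) (X : completePseudoMetricType R).
Hypotheses (hX : hausdorff_space X) (cX : compact [set: X]).
Variable e : nat -> X.
Hypothesis de : dense (range e).

(** Otherwise some sequence has its [I]-th point outside the first [I] sets. A cluster point lies in
    some open [near_net e n i], which the sequence avoids from index [i.+1] on. *)
Lemma compact_finite_net n : exists I, forall x, exists2 i,
  (i < I)%N & near_net e n i x.
Proof.
apply: contrapT => H.
have /choice[x hx] : forall I, exists x, forall i, (i < I)%N -> ~ near_net e n i x.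
  move=> I; apply: contrapT => H1; apply: H; exists I => x.
  apply: contrapT => H2; apply: H1; exists x => i iI xi.
  by apply: H2; exists i.
have [p clp] := compact_seq_cluster x cX.
have [i pi_] := near_net_cover de n p.
have : nbhs p (near_net e n i) by apply: open_nbhs_nbhs; split=> //;
  exact: open_near_net.
by move=> /clp/(_ i.+1)[k ik]; exact: hx.
Qed.

(** Uniform continuity at the scale [5 * radius R n], the precision with which [decodeP] locates a
    point from its digit [n]. *)
Lemma compact_unif_continuous (f : X -> R) (eps : R) : continuous f -> 0 < eps ->
  exists n, forall x y, ball x (5 * radius R n) y -> `|f x - f y| <= eps.
Proof.
move=> cf eps0; apply: contrapT => H.
have /choice[xy hxy] : forall n, exists xy : X * X,
    ball xy.1 (5 * radius R n) xy.2 /\ eps < `|f xy.1 - f xy.2|.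
  move=> n; apply: contrapT => H1; apply: H; exists n => x y bxy.
  by rewrite leNgt; apply/negP => h; apply: H1; exists (x, y).
have [p clp] := compact_seq_cluster (fst \o xy) cX.
have := cf p => /cvgrPdist_lt/(_ _ (divr_gt0 eps0 (@ltr0Sn R 1)))/nbhs_ballP[d /=
  d0 dp].
have [N hN] := radius_small 5 (divr_gt0 d0 (@ltr0Sn R 1)).
have [|n Nn /= pn] := clp (ball p (d / 2)) _ N.
  by apply/nbhs_ballP; exists (d / 2) => //; rewrite /= divr_gt0.
have [b] := hxy n; apply/negP; rewrite -leNgt.
have h1 : `|f p - f (xy n).1| < eps / 2.
  by apply: dp; apply: le_ball pn; lra.
have h2 : `|f p - f (xy n).2| < eps / 2.
  apply: dp; rewrite [d]splitr; apply: ball_triangle pn _.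
  apply: le_ball b; apply: le_trans (ltW hN).
  by rewrite ler_pM2l// ler_wiXn2l ?invr_ge0// invf_le1// ler1n.
rewrite (_ : f (xy n).1 - f (xy n).2 = (f p - f (xy n).2) - (f p - f (xy n).1));
  last by ring.
apply: le_trans (ler_normB _ _) _; lra.
Qed.

Lemma digits_agree n I : exists N, forall c c' : bits, (forall i, (i < N)%N ->
  c i = c' i) ->
  forall i, (i < I)%N -> digit c n i = digit c' n i.
Proof.
elim: I => [|I [N hN]]; first by exists 0%N.
have [M dM] := depends_digit n I.
exists (maxn N M) => c c' cc' i; rewrite ltnS leq_eqVlt => /predU1P[->|iI].
  have agree j : (j < M)%N -> c j = c' j by move=> jM; apply: cc';
    rewrite leq_max jM orbT.
  by apply/idP/idP; apply: dM => j /agree.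
by apply: hN => // j jN; apply/cc'; rewrite leq_max jN.
Qed.

End compact_coding.

Section compact_limit.
Context (R : realType) (X : completePseudoMetricType R).
Hypotheses (hX : hausdorff_space X) (cX : compact [set: X]).
Variable e : nat -> X.
Hypothesis de : dense (range e).

(** Almost surely exactly one digit event with [i < I] holds, and there [f (decode e c)] is
    [eps]-close to [f (e i)]. The sum that results involves only masses of events reading finitely
    many bits, which pass to the limit. *)
Lemma coded_integral_approx (f : X -> R) (eps : R) (q : probability bits R) n I :
  continuous f -> (forall x, 0 <= f x) -> 0 < eps ->
  (forall x y, ball x (5 * radius R n) y -> `|f x - f y| <= eps) ->
  {ae q, forall c, coherent e c} ->
  {ae q, forall c, exists2 i, (i < I)%N & digit c n i} ->
  `|\int[q]_c f (decode e c) -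
    \sum_(i < I) f (e i) * fine (q [set c : bits | digit c n i])| <= eps.
Proof.
move=> cf f0 eps0 feps q1 q2.
set S := \sum_(i < I) _.
have mD i : measurable [set c : bits | digit c n i] by exact: measurable_digit.
pose F c := (f (decode e c))%:E.
pose G (c : bits) := (\sum_(i < I) (f (e i))%:E * (\1_[set c :
  bits | digit c n i] c)%:E)%E.
have F0 c : (0 <= F c)%E by rewrite lee_fin.
have G0 c : (0 <= G c)%E by apply: sume_ge0 => i _; rewrite mule_ge0// lee_fin.
have mF : measurable_fun setT F.
  apply/measurable_EFinP; apply: (measurableT_comp (borel_continuous_measurable cf)).
  exact: measurable_decode.
have mGi i : measurable_fun setT (fun c : bits =>
  (f (e i))%:E * (\1_[set c : bits | digit c n i] c)%:E)%E.
  by apply: measurable_funeM; apply/measurable_EFinP; exact: measurable_indic.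
have mG : measurable_fun setT G by exact: emeasurable_sum.
have GS : (\int[q]_c G c = S%:E)%E.
  rewrite ge0_integral_sum//; last by move=> i c _; rewrite mule_ge0// lee_fin.
  rewrite -sumEFin; apply: eq_bigr => i _.
  have mi : measurable_fun setT (EFin \o \1_[set c : bits | digit c n i] : bits ->
    \bar R).
    by apply/measurable_EFinP; exact: measurable_indic.
  rewrite (ge0_integralZl _ measurableT mi) ?lee_fin//; last by move=> c _;
    rewrite lee_fin.
  rewrite integral_indic// setIT EFinM fineK//; exact: fin_num_measure.
have epsq : (\int[q]_c eps%:E = eps%:E)%E := integral_probability_cst q _.
have close : {ae q, forall c, (F c <= G c + eps%:E)%E /\ (G c <= F c + eps%:E)%E}.
  apply: filterS2 q1 q2 => c cc [i iI di].
  have -> : G c = (f (e i))%:E.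
    rewrite /G (bigD1 (Ordinal iI))//= big1 ?adde0; last first.
      move=> j ji; rewrite indicE memNset ?mule0// => dj.
      by move/eqP: ji; apply; apply: val_inj; exact: digit_uniq dj di.
    by rewrite indicE mem_set// mule1.
  have := feps _ _ (decodeP cc di); rewrite ler_norml -!EFinD !lee_fin => /andP[]; lra.
have h1 : (\int[q]_c F c <= S%:E + eps%:E)%E.
  rewrite -GS -epsq -ge0_integralD//; last by move=> c _; rewrite lee_fin ltW.
  apply: ae_ge0_le_integral => //.
  - by move=> c _; rewrite adde_ge0// lee_fin ltW.
  - exact: emeasurable_funD.
  - by apply: filterS close => c [].
have h2 : (S%:E <= \int[q]_c F c + eps%:E)%E.
  rewrite -GS -epsq -ge0_integralD//; last by move=> c _; rewrite lee_fin ltW.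
  apply: ae_ge0_le_integral => //.
  - by move=> c _; rewrite adde_ge0// lee_fin ltW.
  - exact: emeasurable_funD.
  - by apply: filterS close => c [].
have : (\int[q]_c F c)%E \is a fin_num.
  rewrite ge0_fin_numE; last exact: integral_ge0.
  by apply: le_lt_trans h1 _; rewrite -EFinD ltry.
rewrite /Rintegral -/F => /fineK FE; move: h1 h2; rewrite -FE -!EFinD !lee_fin.
by rewrite ler_norml => *; apply/andP; split; lra.
Qed.

(** The danger is that the limit charges sequences that code no point: having some digit at scale
    [n] reads infinitely many bits and may be lost in the limit. Compactness bounds this digit by
    [I n], which makes it an event on finitely many bits; it has mass one for each [rho N], hence
    for [nu]. *)
Lemma compact_ultralimit (U : set_system nat) (lam : nat -> probability (borel X) R) :
  UltraFilter U -> exists mu : probability (borel X) R,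
  forall f : X -> R, continuous f -> (forall x, 0 <= f x) ->
    (fun N => \int[lam N]_x f x) @ U --> \int[mu]_x f x.
Proof.
move=> UU; have PU : ProperFilter U := @ultra_proper _ _ UU.
pose rho N := push_probability (measurable_code e) (lam N).
have [nu hnu] := ultralimit_bits UU rho.
have /choice[I hI] := fun n => compact_finite_net cX de n.
have aenu n E : depends_below n E -> (forall x, E (code e x)) -> {ae nu, forall c, E c}.
  move=> dE hE; have mE := measurable_depends dE; apply: ae_probability1 => //.
  have h := hnu _ _ dE.
  have : (fun k => fine (rho k E)) @ U --> (1 : R).
    rewrite (_ : (fun _ => _) = cst 1); first exact: cvg_cst.
    apply/funext => k; rewrite push_probabilityE (_ : _ @^-1` _ = setT).
      by rewrite probability_setT.
    by apply/seteqP; split => // x _; exact: hE.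
  move=> h1; have l1 := cvg_lim (@Rhausdorff R) h1;
    have l2 := cvg_lim (@Rhausdorff R) h.
  have nuE : fine (nu E) = 1 by rewrite -l1 -l2.
  by rewrite -(@fineK _ (nu E)) ?fin_num_measure// nuE.
have aerho N (E : set bits) : measurable E -> (forall x, E (code e x)) ->
  {ae rho N, forall c, E c}.
  move=> mE hE; apply: ae_probability1 => //; rewrite push_probabilityE.
  rewrite (_ : _ @^-1` _ = setT) ?probability_setT//.
  by apply/seteqP; split => // x _; exact: hE.
have dnet n : exists N, depends_below N [set c : bits | exists2 i,
  (i < I n)%N & digit c n i].
  have [N hN] := digits_agree n (I n).
  by exists N => c c' cc' [i iI di]; exists i => //; rewrite -(hN _ _ cc').
have net_code n x : exists2 i, (i < I n)%N & digit (code e x) n i.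
  have [i iI xi] := hI n x.
  have [|j ji dj] := @digit_exists (code e x) n i.
    by rewrite /code pickleK; exact/asboolP.
  by exists j => //; exact: leq_ltn_trans iI.
have net_nu n : {ae nu, forall c, exists2 i, (i < I n)%N & digit c n i}.
  by have [N dN] := dnet n; apply: aenu dN _ => x; exact: net_code.
have coh_nu : {ae nu, forall c, coherent e c}.
  have h1 : {ae nu, forall c, forall n, exists2 i, (i < I n)%N & digit c n i}.
    exact: ae_foralln.
  have h2 : {ae nu, forall c, forall n i j, digit c n i -> digit c n.+1 j ->
      ball (e i) (2 * radius R n) (e j)}.
    apply: ae_foralln => n; apply: ae_foralln => i; apply: ae_foralln => j.
    have [N1 h1'] := digits_agree n i.+1; have [N2 h2] := digits_agree n.+1 j.+1.
    apply: (aenu (maxn N1 N2) [set c : bits | digit c n i -> digit c n.+1 j ->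
      ball (e i) (2 * radius R n) (e j)]).
      move=> c c' cc' /= h; rewrite -(h1' c c') ?leqnn// -?(h2 c c') ?leqnn//.
        by move=> k kN; apply: cc'; rewrite leq_max kN orbT.
      by move=> k kN; apply: cc'; rewrite leq_max kN.
    by move=> x; have [_ h] := coherent_code de x; exact: h.
  apply: filterS2 h1 h2 => c c1 c2; split=> // n.
  by have [i _ di] := c1 n; exists i.
exists (push_probability (measurable_decode e) nu) => f cf f0.
have mf : measurable_fun setT (EFin \o f : borel X -> \bar R).
  by apply/measurable_EFinP; exact: borel_continuous_measurable.
have e1 : \int[push_probability (measurable_decode e)
  nu]_x f x = \int[nu]_c f (decode e c).
  by rewrite /Rintegral integral_push// => y; rewrite lee_fin.
have e2 N : \int[lam N]_x f x = \int[rho N]_c f (decode e c).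
  rewrite /Rintegral /rho (@integral_push _ _ _ _ _ _ _ _ (fun c =>
    (f (decode e c))%:E)).
  - by congr fine; apply: eq_integral => x _; rewrite codeK.
  - apply/measurable_EFinP; apply: (measurableT_comp (borel_continuous_measurable cf)).
    exact: measurable_decode.
  - by move=> y; rewrite lee_fin.
rewrite e1; under eq_fun do rewrite e2.
apply/cvgrPdist_le => eps eps0.
(* One third each for discretising under [nu], for the convergence of the discretised sums, and for
   discretising under [rho N]. *)
have eps3 : 0 < eps / 3 by rewrite divr_gt0.
have [n hn] := compact_unif_continuous cX cf eps3.
have := coded_integral_approx (n := n) (I := I n) cf f0 eps3 hn coh_nu (net_nu n).
set a := \int[nu]_c _; set s := \sum_(i < I n) _ => h1.
have : (fun N => \sum_(i < I n) f (e i) * fine (rho N [set c :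
  bits | digit c n i])) @ U --> s.
  apply: cvg_big => [|i _]; first exact: add_continuous.
  apply: cvgMr.
  by have [N dN] := depends_digit n i; exact: hnu dN.
move=> /cvgrPdist_le/(_ _ eps3); apply: filterS => N hN.
have h2 := coded_integral_approx (q := rho N) (n := n) (I := I n) cf f0 eps3 hn.
have {h2} := h2 (aerho N _ (measurable_coherent e) (coherent_code de)).
have [K dK] := dnet n.
move=> /(_ (aerho N _ (measurable_depends dK) (net_code n))).
move: hN h1; set b := \int[rho N]_c _; set t := \sum_(i < I n) _.
rewrite !ler_norml => /andP[? ?] /andP[? ?] /andP[? ?].
by apply/andP; split; lra.
Qed.

End compact_limit.

Definition kernel_at d d' (A : measurableType d) (B : measurableType d') (R : realType)
  (k : R.-pker A ~> B) (a : A) : probability B R :=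
    to_probability (prob_kernel (s := k) a).

Lemma integral_kernel_at d d' (A : measurableType d) (B : measurableType d') (R :
  realType)
    (k : R.-pker A ~> B) (a : A) (f : B -> \bar R) :
  (\int[kernel_at k a]_b f b = \int[k a]_b f b)%E.
Proof. exact: integral_to_probability. Qed.

Lemma measurable_kernel_at d d' (A : measurableType d) (B : measurableType d') (R :
  realType)
    (k : R.-pker A ~> B) U : measurable U -> measurable_fun setT (fun a =>
      kernel_at k a U).
Proof. exact: measurable_kernel. Qed.

Section krylov_bogoliubov.
Context (R : realType) (X : completePseudoMetricType R).

Lemma kernel_step_exists (T : R.-pker (borel X) ~> (borel X)) (m :
  probability (borel X) R) :
  exists p : probability (borel X) R,
    (forall A, measurable A -> p A = \int[m]_x T x A)%E /\
    (forall f, measurable_fun setT f -> (forall y, 0 <= f y)%E ->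
      \int[p]_y f y = \int[m]_x \int[T x]_y f y)%E.
Proof.
have mT A : measurable A -> measurable_fun setT (fun x => kernel_at T x A).
  by move=> mA; exact: measurable_kernel_at.
have [p [p1 p2]] := mixture_exists m mT; exists p; split => [A mA|f mf f0];
  first exact: p1.
by rewrite p2//; apply: eq_integral => x _; rewrite integral_kernel_at.
Qed.

Lemma cesaro_mean_exists (m : nat -> probability (borel X) R) N :
  exists p : probability (borel X) R,
    forall f, measurable_fun setT f -> (forall y, 0 <= f y)%E ->
      (\int[p]_y f y = (N.+1%:R^-1)%:E * \sum_(k < N.+1) \int[m k]_y f y)%E.
Proof.
have N0 : (0 : R) <= N.+1%:R^-1 by rewrite invr_ge0.
pose q := mscale (NngNum N0) (msum m N.+1).
have q1 : q setT = 1%E.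
  rewrite /q /mscale/= /msum/= (eq_bigr (fun=> 1%E)); last by move=> k _;
    rewrite probability_setT.
  rewrite sumEFin sumr_const card_ord -EFinM; congr EFin.
  by rewrite mulVf// pnatr_eq0.
exists (to_probability q1) => f mf f0.
by rewrite integral_to_probability ge0_integral_mscale// ge0_integral_measure_sum.
Qed.

(** Invariance is tested on lattice functions [f]. The Feller property makes [Tf] continuous, so the
    integrals of both [f] and [Tf] pass to the limit of the Cesaro means. *)
Lemma krylov_bogoliubov (T : R.-pker (borel X) ~> (borel X)) :
  polish X -> compact [set: X] -> weakly_continuous T ->
  exists mu : probability (borel X) R,
    forall A, measurable A -> (mu A = \int[mu]_x T x A)%E.
Proof.
move=> [hX [D cD dD]] cX wT; have [e de] := dense_sequence_exists cD dD.
have [step hstep] := choice (kernel_step_exists T).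
pose m k := iter k step (\d_ (point : borel X))%R.
have [avg havg] := choice (cesaro_mean_exists m).
have [U [UU ooU]] := ultraFilterLemma (F := \oo) _.
have [mu hmu] := compact_ultralimit hX cX de avg UU.
have PU : ProperFilter U := @ultra_proper _ _ UU.
exists mu => A mA; have [h1 h2] := hstep mu; rewrite -h1//.
apply: (probability_borel_eq de) => // l.
pose f := lattice_fun e l.
have cf : continuous f by exact: lattice_fun_continuous.
have f0 x : 0 <= f x by exact: lattice_fun_ge0.
have mf : measurable_fun setT (EFin \o f : borel X -> \bar R).
  by apply/measurable_EFinP; exact: borel_continuous_measurable.
pose Tf x := \int[T x]_y f y.
have TfE x : (\int[T x]_y (f y)%:E = (Tf x)%:E)%E.
  have := integral_lattice_fun e l (kernel_at T x).
  by rewrite /Rintegral integral_kernel_at.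
have cTf : continuous Tf by apply: wT => //; exact: lattice_fun_bounded_fun.
have Tf0 x : 0 <= Tf x.
  by rewrite -lee_fin -TfE; apply: integral_ge0 => y _; rewrite lee_fin.
have mTf : measurable_fun setT (EFin \o Tf : borel X -> \bar R).
  by apply/measurable_EFinP; exact: borel_continuous_measurable.
rewrite h2//.
under [RHS]eq_integral do rewrite TfE.
have [M hM] := lattice_fun_bounded e l.
have M0 : 0 <= M := le_trans (f0 point) (hM point).
have intM (q : probability (borel X) R) : (\int[q]_x (f x)%:E <= M%:E)%E.
  rewrite -(integral_probability_cst q M%:E); by apply: ge0_le_integral => // x _;
    rewrite lee_fin.
pose a k := \int[m k]_x f x.
have aE k : (\int[m k]_x (f x)%:E = (a k)%:E)%E by exact: integral_lattice_fun.
have a0M k : 0 <= a k <= M.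
  rewrite -!lee_fin -aE intM andbT; apply: integral_ge0 => x _; by rewrite lee_fin.
have aSE k : (\int[m k]_x (Tf x)%:E = (a k.+1)%:E)%E.
  rewrite -aE /m iterS -/(m k); have [_ ->] := hstep (m k) => //.
  by apply: eq_integral => x _; rewrite TfE.
have avgf N : \int[avg N]_x f x = N.+1%:R^-1 * \sum_(k < N.+1) a k.
  rewrite /Rintegral havg//.
  by rewrite (eq_bigr (fun k : 'I_N.+1 => (a k)%:E)) ?sumEFin// => k _; rewrite aE.
have avgTf N : \int[avg N]_x Tf x = N.+1%:R^-1 * \sum_(k < N.+1) a k.+1.
  rewrite /Rintegral havg//.
  by rewrite (eq_bigr (fun k : 'I_N.+1 => (a k.+1)%:E)) ?sumEFin// => k _; rewrite aSE.
(* The difference telescopes to [(a N.+1 - a 0) / N.+1], of absolute value at most [M / N.+1]. *)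
have diff0 : (fun N => \int[avg N]_x Tf x - \int[avg N]_x f x) @ U --> (0 : R).
  suff : (fun N => \int[avg N]_x Tf x - \int[avg N]_x f x) @ \oo --> (0 : R).
    by move=> h V /h; exact: ooU.
  apply/cvgrPdist_le => eps eps0.
  have [n hn] : exists n : nat, M / eps < n%:R.
    by exists (Num.bound (M / eps)); rewrite archi_boundP// divr_ge0// ltW.
  exists n => // N /= nN; rewrite sub0r normrN avgf avgTf -mulrBr -sumrB.
  rewrite (eq_bigr (fun k : 'I_N.+1 => a (nat_of_ord k).+1 - a (nat_of_ord k)))//.
  rewrite -(big_mkord xpredT (fun k => a k.+1 - a k)) telescope_sumr//.
  rewrite normrM ger0_norm ?invr_ge0// mulrC ler_pdivrMr//.
  have : `|a N.+1 - a 0%N| <= M.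
    have := a0M N.+1; have := a0M 0%N => /andP[? ?] /andP[? ?].
    by rewrite ler_norml; apply/andP; split; lra.
  move=> /le_trans; apply; rewrite mulrC -ler_pdivrMr//; apply: le_trans (ltW hn) _.
  by rewrite ler_nat ltnW.
have eqf : \int[mu]_x f x = \int[mu]_x Tf x.
  apply/eqP; rewrite -subr_eq0 -opprB oppr_eq0; apply/eqP.
  have h : (fun N => \int[avg N]_x Tf x - \int[avg N]_x f x) @ U -->
      \int[mu]_x Tf x - \int[mu]_x f x.
    by apply: cvgB; exact: hmu.
  by rewrite -(cvg_lim (@Rhausdorff R) h) -(cvg_lim (@Rhausdorff R) diff0).
rewrite integral_lattice_fun -/f eqf /Rintegral fineK// ge0_fin_numE; last first.
  by apply: integral_ge0 => x _; rewrite lee_fin.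
apply: (@le_lt_trans _ _ M%:E); last exact: ltry.
rewrite -(integral_probability_cst mu M%:E); apply: ge0_le_integral => // x _.
  by rewrite lee_fin.
by rewrite /= -TfE -integral_kernel_at.
Qed.

End krylov_bogoliubov.

(** * Disintegration *)

Section family_kernel.
Context d d' (A : measurableType d) (B : measurableType d') (R : realType).
Local Open Scope ereal_scope.
Variable k : A -> probability B R.
Hypothesis mk : forall U, measurable U -> measurable_fun setT (fun a => k a U).

Definition family_kernel of
  (forall U, measurable U -> measurable_fun setT (fun a => k a U)) :
  A -> {measure set B -> \bar R} := k.

Let K := family_kernel mk.

Let mK U : measurable U -> measurable_fun setT (K ^~ U).
Proof. exact: mk. Qed.

HB.instance Definition _ := isKernel.Build _ _ _ _ _ K mK.

Let K1 a : K a setT = 1.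
Proof. exact: probability_setT. Qed.

HB.instance Definition _ := Kernel_isProbability.Build _ _ _ _ _ K K1.

Lemma measurable_family_integral (f : A * B -> \bar R) :
  measurable_fun setT f -> (forall z, 0 <= f z) ->
  measurable_fun setT (fun a => \int[k a]_b f (a, b)).
Proof. by move=> mf f0; exact: (measurable_fun_integral_finite_kernel _ K f0 mf). Qed.

Lemma joint_exists (m : probability A R) :
  exists p : probability (A * B)%type R,
    forall f : A * B -> \bar R, measurable_fun setT f -> (forall z, 0 <= f z) ->
      \int[p]_z f z = \int[m]_a \int[k a]_b f (a, b).
Proof.
pose k' a : probability (A * B)%type R := push_probability (measurable_pair1 a) (k a).
have mk' U : measurable U -> measurable_fun setT (fun a => k' a U).
  move=> mU.
  rewrite (_ : (fun a => _) = (fun a => \int[k a]_b (\1_U (a, b))%:E)).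
    apply: (measurable_family_integral (f := fun z => (\1_U z)%:E)).
      by apply/measurable_EFinP; exact: measurable_indic.
    by move=> z; rewrite lee_fin.
  apply/funext => a; rewrite push_probabilityE.
  rewrite -[X in k a X]setIT -integral_indic//.
  by rewrite -[X in measurable X]setTI; exact: measurable_pair1.
have [p [_ hp]] := mixture_exists m mk'.
exists p => f mf f0; rewrite hp//; apply: eq_integral => a _.
by rewrite integral_push.
Qed.

End family_kernel.

Lemma probability_prod_eq d d' (A : measurableType d) (B : measurableType d')
    (R : realType) (p q : probability (A * B)%type R) :
  (forall U V, measurable U -> measurable V -> p (U `*` V) = q (U `*` V)) ->
  forall E, measurable E -> p E = q E.
Proof.
move=> pq E mE.
pose G := [set E : set (A * B) | exists U V, [/\ measurable U,
  measurable V & E = U `*` V]].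
apply: (@measure_unique _ R (A * B)%type G (fun=> setT)) => //.
- rewrite measurable_prod_measurableType; congr (<<s _ >>); apply/seteqP; split.
    by move=> _ [U mU [V mV <-]]; exists U, V.
  by move=> _ [U [V [mU mV ->]]]; exists U => //; exists V.
- move=> _ _ [U1 [V1 [mU1 mV1 ->]]] [U2 [V2 [mU2 mV2 ->]]].
  exists (U1 `&` U2), (V1 `&` V2); rewrite setXI; split => //; exact: measurableI.
- by move=> _; exists setT, setT; rewrite setXTT.
- by rewrite bigcup_const//; exists 0%N.
- by move=> _ [U [V [mU mV ->]]]; exact: pq.
- by move=> _; apply: (le_lt_trans (probability_le1 p measurableT)); rewrite ltry.
Qed.

Section slice_measure.
Context d d' (H : measurableType d) (Z : measurableType d') (R : realType).
Variables (lam : probability Z R) (p : Z -> H) (mp : measurable_fun setT p).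
Variables (E : set Z) (mE : measurable E).

Definition slice_measure of measurable_fun setT p & measurable E : set H -> \bar R :=
  fun C => lam (p @^-1` C `&` E).

Let nu := slice_measure mp mE.

Let mpre C : measurable C -> measurable (p @^-1` C).
Proof. by move=> mC; rewrite -[X in measurable X]setTI; exact: mp. Qed.

Let nu0 : nu set0 = 0%E.
Proof. by rewrite /nu /slice_measure preimage_set0 set0I measure0. Qed.

Let nu_ge0 A : (0 <= nu A)%E. Proof. exact: measure_ge0. Qed.

Let nu_sigma_additive : semi_sigma_additive nu.
Proof.
move=> F mF tF mUF; rewrite /nu /slice_measure preimage_bigcup setI_bigcupl.
apply: measure_semi_sigma_additive.
- by move=> n; apply: measurableI => //; exact: mpre.
- apply/trivIsetP => i j _ _ ij.
  rewrite setIACA -preimage_setI.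
  by move/trivIsetP : tF => /(_ i j Logic.I Logic.I ij) ->; rewrite preimage_set0 set0I.
- by apply: bigcupT_measurable => n; apply: measurableI => //; exact: mpre.
Qed.

HB.instance Definition _ := isMeasure.Build _ _ _ nu nu0 nu_ge0 nu_sigma_additive.

Let nu_fin : fin_num_fun nu.
Proof.
move=> C mC; rewrite /nu /slice_measure fin_num_measure//.
by apply: measurableI => //; exact: mpre.
Qed.

HB.instance Definition _ := Measure_isFinite.Build _ _ _ nu nu_fin.

(** The conditional probability of [E] given [p], as the Radon-Nikodym derivative of [nu] with
    respect to the law of [p]. *)
Lemma slice_density_exists : exists f : H -> \bar R,
  [/\ measurable_fun setT f, forall h, (0 <= f h)%E, forall h, f h \is a fin_num,
      (push_probability mp lam).-integrable setT f &
      forall C, measurable C ->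
        (lam (p @^-1` C `&` E) = \int[push_probability mp lam]_(h in C) f h)%E].
Proof.
have dom : nu `<< push_probability mp lam.
  apply/null_content_dominatesP => C mC C0; apply/eqP; rewrite eq_le measure_ge0 andbT.
  apply: (@le_trans _ _ (push_probability mp lam C)); last by rewrite C0.
  rewrite push_probabilityE; apply: le_measure; rewrite ?inE.
  - by apply: measurableI => //; exact: mpre.
  - exact: mpre.
  - exact: subIsetl.
exists (Radon_Nikodym_SigmaFinite.f nu (push_probability mp lam)); split.
- by have /integrableP[] := Radon_Nikodym_SigmaFinite.f_integrable dom.
- by move=> h; exact: Radon_Nikodym_SigmaFinite.f_ge0.
- by move=> h; exact: Radon_Nikodym_SigmaFinite.f_fin_num.
- exact: Radon_Nikodym_SigmaFinite.f_integrable.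
- by move=> C mC; rewrite -Radon_Nikodym_SigmaFinite.f_integral.
Qed.

End slice_measure.

Lemma ae_forall_countable d (T : measurableType d) (R : realType)
    (m : {measure set T -> \bar R}) (I : countType) (Q : I -> T -> Prop) :
  (forall i, {ae m, forall x, Q i x}) -> {ae m, forall x, forall i, Q i x}.
Proof.
move=> hQ.
have : {ae m, forall x, forall n, if unpickle n is Some i then Q i x else True}.
  apply: ae_foralln => n; case: (unpickle n) => [i|]; first exact: hQ.
  exact: aeW.
by apply: filterS => x h i; have := h (pickle i); rewrite pickleK.
Qed.

(** Conditional probabilities of cylinders satisfy each additivity relation almost surely. There are
    countably many relations, so off one null set [N] they are additive weights and define a
    probability on [bits]. *)
Lemma bits_disintegration d d' (H : measurableType d) (Z : measurableType d')
    (R : realType) (lam : probability Z R) (p : Z -> H) (mp : measurable_fun setT p)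
    (c : Z -> bits) (mc : measurable_fun setT c) :
  exists k : H -> probability bits R,
    (forall E, measurable E -> measurable_fun setT (fun h => k h E)) /\
    (forall E C, measurable E -> measurable C ->
       lam (p @^-1` C `&` c @^-1` E) = \int[push_probability mp lam]_(h in C) k h E)%E.
Proof.
have mpre E : measurable E -> measurable (c @^-1` E).
  by move=> mE; rewrite -[X in measurable X]setTI; exact: mc.
have mpreH C : measurable C -> measurable (p @^-1` C).
  by move=> mC; rewrite -[X in measurable X]setTI; exact: mp.
set m := push_probability mp lam.
have [f hf] := choice (fun s =>
  slice_density_exists lam mp (mpre _ (measurable_cylinder s))).
have fint s : m.-integrable setT (f s) by have [] := hf s.
have fm s : measurable_fun setT (f s) by have [] := hf s.
have fC s C : measurable C -> (lam (p @^-1` C `&` c @^-1` cylinder s)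
  = \int[m]_(h in C) f s h)%E.
  by have [_ _ _ _] := hf s; apply.
have f0 s h : (0 <= f s h)%E by have [] := hf s.
have ffin s h : f s h \is a fin_num by have [] := hf s.
pose w s h := fine (f s h).
have wE s h : (w s h)%:E = f s h by rewrite fineK.
have ae1 : {ae m, forall h, f [::] h = 1%E}.
  have : ae_eq m setT (f [::]) (cst 1%E).
    apply: integral_ae_eq => // C _ mC; rewrite -fC// integral_cst// mul1e.
    congr (lam _); rewrite (_ : cylinder [::] = setT) ?preimage_setT ?setIT//.
    by apply/seteqP; split.
  by apply: filterS => h; exact.
have aeD : {ae m, forall h, forall s, f s h = (f (true :: s) h + f (false :: s) h)%E}.
  apply: ae_forall_countable => s.
  have : ae_eq m setT (f s) (f (true :: s) \+ f (false :: s))%E.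
    apply: integral_ae_eq => //; first exact: emeasurable_funD.
    move=> C _ mC; rewrite ge0_integralD//; try exact: measurable_funTS.
    rewrite -!fC// cylinder_cons preimage_setU setIUr measureU//.
    - by apply: measurableI; [exact: mpreH|apply: mpre; exact: measurable_cylinder].
    - by apply: measurableI; [exact: mpreH|apply: mpre; exact: measurable_cylinder].
    - by rewrite setIACA -[X in _ `&`
        X]preimage_setI cylinder_cons_disj preimage_set0 setI0.
  by apply: filterS => h; exact.
have : {ae m, forall h, additive_weights (w ^~ h)}.
  apply: filterS2 ae1 aeD => h h1 hD; split => [|s|s].
  - by rewrite /w h1.
  - by rewrite fine_ge0.
  - by rewrite /w hD fineD.
move=> [N [mN N0 hN]].
(* The weights of the Dirac mass at the zero sequence, used as a default value on [N]. *)
pose w0 (s : seq bool) : R := (all negb s)%:R.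
have aw0 : additive_weights w0.
  by split => // s; rewrite /w0/= ?add0r// ler0n.
pose w' s h := if h \in N then w0 s else w s h.
have aw' h : additive_weights (w' ^~ h).
  rewrite /w'; case: (boolP (h \in N)) => // /negP hN'.
  by apply: contrapT => na; apply: hN'; rewrite inE; exact: hN.
have mw' s : measurable_fun setT (fun h => (w' s h)%:E).
  rewrite (_ : (fun h => _) = (fun h => if h \in N then (w0 s)%:E else f s h)).
    apply: measurable_fun_ifT => //.
    apply: (measurable_fun_bool true); rewrite setTI (_ : _ @^-1` _ = N)//.
    by apply/seteqP; split => h; [move/set_mem|move/mem_set].
  by apply/funext => h; rewrite /w'; case: ifP; rewrite ?wE.
have [K hK] : exists K : H -> probability bits R, forall h s, K h (cylinder s)
  = (w' s h)%:E.
  by exists (fun h => weights_probability (w' ^~ h)) => h s;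
    exact: weights_probabilityE.
exists K.
(* Measurability in [h] is also known only on cylinders, so it is carried along with the integral
   formula through the Dynkin argument. *)
pose Q E := measurable_fun setT (fun h => K h E) /\
  (forall C, measurable C -> lam (p @^-1` C `&` c @^-1` E) =
     \int[m]_(h in C) K h E)%E.
suff hQ E : measurable E -> Q E.
  by split=> [E mE|E C mE mC]; have [h1 h2] := hQ E mE; [exact: h1|exact: h2].
have Qcyl s : Q (cylinder s).
  split.
    under eq_fun do rewrite hK; exact: mw'.
  move=> C mC; rewrite fC//; apply: ge0_ae_eq_integral => //.
  - exact: measurable_funTS.
  - under eq_fun do rewrite hK; apply: measurable_funTS; exact: mw'.
  - exists N; split=> // h hnot; apply: contrapT => hN'; apply: hnot => _.
    by rewrite hK /w' memNset.
have Q0 : Q set0.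
  split; first by under eq_fun do rewrite measure0; exact: measurable_cst.
  move=> C mC; rewrite preimage_set0 setI0 measure0; apply/esym/integral0_eq => h _.
  by rewrite measure0.
have QU A B : measurable A -> measurable B -> A `&` B = set0 -> Q A -> Q B ->
  Q (A `|` B).
  move=> mE mF EF [mQE hE] [mQF hF].
  have add h : K h (A `|` B) =
      (K h A + K h B)%E.
    by rewrite measureU.
  split; first by under eq_fun do rewrite add; exact: emeasurable_funD.
  move=> C mC; under eq_integral do rewrite add.
  rewrite ge0_integralD//; try exact: measurable_funTS.
  rewrite -hE// -hF// preimage_setU setIUr measureU//.
  - by apply: measurableI; [exact: mpreH|exact: mpre].
  - by apply: measurableI; [exact: mpreH|exact: mpre].
  - by rewrite setIACA -[X in _ `&` X]preimage_setI EF preimage_set0 setI0.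
have QT : Q setT.
  by rewrite (_ : setT = cylinder [::])//; apply/seteqP; split.
move=> mE; rewrite bits_measurableE in mE.
apply: (@dynkin_induction _ bits _ Q bits_measurableE setI_closed_depends QT _ _ _
  E mE).
- move=> A [n dA]; apply: (@depends_ind Q n A dA Q0 Qcyl) => s Q1 Q2.
  rewrite cylinder_cons setIUl; apply: QU; last 2 first.
  + exact: Q1.
  + exact: Q2.
  + by apply: measurableI; [exact: measurable_cylinder|exact: measurable_depends dA].
  + by apply: measurableI; [exact: measurable_cylinder|exact: measurable_depends dA].
  + by rewrite setIACA cylinder_cons_disj set0I.
- move=> A mA [mQA hA].
  have compl h : K h (~` A) = (1 - K h A)%E.
    by rewrite probability_setC.
  split; first by under eq_fun do rewrite compl; exact: emeasurable_funB.
  move=> C mC.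
  have e1 : (lam (p @^-1` C `&` c @^-1` A) + lam (p @^-1` C `&` c @^-1` (~` A)) =
      \int[m]_(h in C) K h A +
      \int[m]_(h in C) K h (~` A))%E.
    rewrite -ge0_integralD//; last 2 first.
    + exact: measurable_funTS.
    + by apply: measurable_funTS; under eq_fun do rewrite compl;
        exact: emeasurable_funB.
    have -> : (\int[m]_(h in C) (K h A + K h (~` A)) = m C)%E.
      rewrite -[RHS]mul1e -integral_cst//; apply: eq_integral => h _.
      rewrite -measureU//; [|exact: measurableC|by rewrite setICr].
      by rewrite setUv; exact: probability_setT.
    rewrite -measureU//.
    + by rewrite -setIUr -preimage_setU setUv preimage_setT setIT.
    + by apply: measurableI; [exact: mpreH|exact: mpre].
    + by apply: measurableI; [exact: mpreH|apply: mpre; exact: measurableC].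
    + by rewrite setIACA -[X in _ `&` X]preimage_setI setICr preimage_set0 setI0.
  move: e1; rewrite hA// => /(congr1 (fun x => x - \int[m]_(h in C) K h A)%E).
  have fin : (\int[m]_(h in C) K h A)%E \is a fin_num.
    rewrite -hA// fin_num_measure//.
    by apply: measurableI; [exact: mpreH|exact: mpre].
  have eK y : (\int[m]_(h in C) K h A + y - \int[m]_(h in C) K h A = y)%E.
    by rewrite addeC addeA [(- _ + _)%E]addeC subee// add0e.
  by rewrite /= !eK.
- move=> F mF tF QF.
  have add h : K h (\bigcup_k F k) =
      (\sum_(0 <= k <oo) K h (F k))%E.
    apply/esym/cvg_lim => //; apply: measure_semi_sigma_additive => //.
    exact: bigcupT_measurable.
  split.
    under eq_fun do rewrite add; apply: ge0_emeasurable_sum => // k _.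
    by have [] := QF k.
  move=> C mC; under eq_integral do rewrite add.
  rewrite integral_nneseries//; last by move=> k; apply: measurable_funTS;
    have [] := QF k.
  rewrite preimage_bigcup setI_bigcupr; apply/esym/cvg_lim => //.
  under eq_fun => n do under eq_bigr => k _ do rewrite -(QF k).2//.
  apply: measure_semi_sigma_additive.
  + by move=> n; apply: measurableI; [exact: mpreH|exact: mpre].
  + apply/trivIsetP => i j _ _ ij; rewrite setIACA -[X in _ `&` X]preimage_setI.
    by move/trivIsetP : tF => /(_ i j Logic.I Logic.I ij) ->;
      rewrite preimage_set0 setI0.
  + by apply: bigcupT_measurable => n; apply: measurableI; [exact: mpreH|exact: mpre].
Qed.

Lemma eq_probability_integral d (T : measurableType d) (R : realType)
    (p q : probability T R) (f : T -> \bar R) :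
  (forall E, measurable E -> p E = q E) -> (\int[p]_x f x = \int[q]_x f x)%E.
Proof. by move=> pq; apply: eq_measure_integral => E mE _; exact: pq. Qed.

Lemma joint_rectangle d d' (A : measurableType d) (B : measurableType d') (R : realType)
    (m : probability A R) (k : A -> probability B R) (p : probability (A * B)%type R) :
  (forall f : A * B -> \bar R, measurable_fun setT f -> (forall z, 0 <= f z)%E ->
      \int[p]_z f z = \int[m]_a \int[k a]_b f (a, b))%E ->
  forall U V, measurable U -> measurable V ->
    (p (U `*` V) = \int[m]_(a in U) k a V)%E.
Proof.
move=> hp U V mU mV; have mUV : measurable (U `*` V) by exact: measurableX.
rewrite -[U `*` V]setIT -integral_indic// hp//; last first.
  by apply/measurable_EFinP; exact: measurable_indic.
rewrite [RHS]integral_mkcond; apply: eq_integral => a _; rewrite patchE.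
rewrite (eq_integral (fun b => (\1_U a)%:E * (\1_V b)%:E)%E); last first.
  by move=> b _; rewrite !indicE in_setX/=; case: (a \in U); case: (b \in V);
    rewrite ?mul1e ?mule0 ?mul0e.
rewrite indicE; case: (boolP (a \in U)) => aU /=.
  by under eq_integral do rewrite mul1e; rewrite integral_indic// setIT.
by under eq_integral do rewrite mul0e; rewrite integral0.
Qed.

(** The conditional law is built for the code of the second coordinate and pushed back by [decode];
    [codeK] makes the round trip exact. *)
Lemma disintegration (R : realType) (X : completePseudoMetricType R)
    (d : measure_display) (H : measurableType d)
    (lam : probability (H * borel X)%type R) : polish X ->
  exists g : H -> probability (borel X) R,
    (forall A, measurable A -> measurable_fun setT (fun h => g h A)) /\
    (forall f : H * borel X -> \bar R, measurable_fun setT f ->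
      (forall z, 0 <= f z)%E ->
      \int[lam]_z f z =
      \int[push_probability measurable_fst lam]_h \int[g h]_x f (h, x))%E.
Proof.
move=> [hX [D cD dD]]; have [e de] := dense_sequence_exists cD dD.
have mc : measurable_fun setT (code e \o snd : H * borel X -> bits).
  exact: measurableT_comp (measurable_code e) measurable_snd.
have [k [mk hk]] := bits_disintegration lam measurable_fst mc.
pose g h := push_probability (measurable_decode e) (k h).
have mdec A : measurable A -> measurable (decode e @^-1` A).
  by move=> mA; rewrite -[X in measurable X]setTI; exact: measurable_decode.
have mg A : measurable A -> measurable_fun setT (fun h => g h A).
  by move=> mA; apply: mk; exact: mdec.
exists g; split=> // f mf f0.
have [p hp] := joint_exists mg (push_probability measurable_fst lam).
rewrite -hp//; apply: eq_probability_integral; apply: probability_prod_eq => C A mC mA.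
rewrite (joint_rectangle hp)// -hk//; last exact: mdec.
congr (lam _); apply/seteqP; split => -[h x] /=; by rewrite codeK.
Qed.

(** * The stationary observation history *)

(** Prepends the coded observation [a] to the history [b]. Iterated, it stores the latest
    observation at positions 0, 2, 4, ..., the one before at 1, 5, 9, ..., and so on, so one bit
    sequence holds infinitely many observations. *)
Definition interleave (a b : bits) : bits := fun n => if odd n then b n./2 else a n./2.
Definition even_part (c : bits) : bits := fun n => c n.*2.
Definition odd_part (c : bits) : bits := fun n => c n.*2.+1.
Definition truncate k (c : bits) : bits := fun n => (n < k)%N && c n.

Lemma even_interleave a b : even_part (interleave a b) = a.
Proof. by apply/funext => n; rewrite /even_part /interleave odd_double doubleK. Qed.

Lemma odd_interleave a b : odd_part (interleave a b) = b.
Proof. by apply/funext => n;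
  rewrite /odd_part /interleave /= odd_double/= uphalf_double. Qed.

Lemma measurable_fun_interleave d (A : measurableType d) (f g : A -> bits) :
  measurable_fun setT f -> measurable_fun setT g ->
  measurable_fun setT (fun a => interleave (f a) (g a)).
Proof.
move=> mf mg; apply: measurable_fun_bits => n; rewrite /interleave; case: (odd n).
  rewrite (_ : mkset _ = g @^-1` [set c : bits | c n./2])// -[X in measurable X]setTI.
  by apply: mg => //; exact: measurable_coordinate.
rewrite (_ : mkset _ = f @^-1` [set c : bits | c n./2])// -[X in measurable X]setTI.
by apply: mf => //; exact: measurable_coordinate.
Qed.

Lemma measurable_even_part : measurable_fun setT even_part.
Proof. by apply: measurable_fun_bits => n; exact: measurable_coordinate. Qed.

Lemma measurable_odd_part : measurable_fun setT odd_part.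
Proof. by apply: measurable_fun_bits => n; exact: measurable_coordinate. Qed.

Lemma measurable_truncate k : measurable_fun setT (truncate k).
Proof.
apply: measurable_fun_bits => n; rewrite /truncate; case: (n < k)%N => /=.
  exact: measurable_coordinate.
by rewrite (_ : mkset _ = set0)//; apply/seteqP; split.
Qed.

Section stationary_history.
Context (R : realType) (X Y : completePseudoMetricType R).
Hypothesis pX : polish X.
Variables (T : R.-pker (borel X) ~> (borel X)) (Q : R.-pker (borel X) ~> (borel Y)).
Variable eY : nat -> Y.
Variable mu : probability (borel X) R.
Hypothesis mu_inv : forall A, measurable A -> (mu A = \int[mu]_x T x A)%E.
Local Open Scope ereal_scope.

(* The code of the observations up to the present, and the present hidden
   state. *)
Let state := (bits * borel X)%type.

Lemma measurable_remember : measurable_fun setT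
  (fun z : state * (borel X * borel Y) => (interleave (code eY z.2.2) z.1.1, z.2.1)
    : state).
Proof.
apply/measurable_fun_pairP; split => /=.
  apply: measurable_fun_interleave.
    apply: (measurableT_comp (measurable_code eY)).
    exact: (measurableT_comp measurable_snd measurable_snd).
  exact: (measurableT_comp measurable_fst measurable_fst).
exact: (measurableT_comp measurable_fst measurable_snd).
Qed.

Lemma transition_exists (x : borel X) : exists p :
  probability (borel X * borel Y)%type R,
  forall f : borel X * borel Y -> \bar R, measurable_fun setT f ->
    (forall z, 0 <= f z) ->
    \int[p]_z f z = \int[T x]_x1 \int[Q x1]_y f (x1, y).
Proof.
have [p hp] := joint_exists (measurable_kernel_at Q) (kernel_at T x).
by exists p => f mf f0; rewrite hp// integral_kernel_at.
Qed.

Lemma measurable_two_step_integral d (A : measurableType d) (u : A ->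
  borel X) (f : A * (borel X * borel Y) -> \bar R) :
  measurable_fun setT u -> measurable_fun setT f -> (forall z, 0 <= f z) ->
  measurable_fun setT (fun a => \int[T (u a)]_x1 \int[Q x1]_y f (a, (x1, y))).
Proof.
move=> mu_ mf f0.
have m1 : measurable_fun setT (fun z : A * borel X => \int[Q z.2]_y f (z.1, (z.2, y))).
  have mk U : measurable U -> measurable_fun setT (fun z : A * borel X =>
    kernel_at Q z.2 U).
    by move=> mU; exact: (measurableT_comp (measurable_kernel_at Q mU) measurable_snd).
  apply: (measurable_family_integral mk (f := fun w : (A * borel X) * borel Y =>
    f (w.1.1, (w.1.2, w.2)))) => //.
  apply: (measurableT_comp mf); apply/measurable_fun_pairP; split => /=.
    exact: (measurableT_comp measurable_fst measurable_fst).
  apply/measurable_fun_pairP; split => //=.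
  exact: (measurableT_comp measurable_snd measurable_fst).
  exact: measurable_snd.
have mk U : measurable U -> measurable_fun setT (fun a => kernel_at T (u a) U).
  by move=> mU; exact: (measurableT_comp (measurable_kernel_at T mU) mu_).
apply: (measurable_family_integral mk m1) => z.
exact: integral_ge0.
Qed.

(** The transition operator of the pair (history, hidden state), acting on test functions. *)
Let remember (f : state -> \bar R) (z : state) : \bar R :=
  \int[T z.2]_x1 \int[Q x1]_y f (interleave (code eY y) z.1, x1).

Let remember_ge0 f z : (forall z, 0 <= f z) -> 0 <= remember f z.
Proof. by move=> f0; apply: integral_ge0 => x1 _; exact: integral_ge0. Qed.

Let measurable_remember_fun f : measurable_fun setT f -> (forall z, 0 <= f z) ->
  measurable_fun setT (remember f).
Proof.
move=> mf f0.
apply: (@measurable_two_step_integral _ state snd (fun w =>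
  f (interleave (code eY w.2.2) w.1.1, w.2.1))) => //.
exact: (measurableT_comp mf measurable_remember).
Qed.

Lemma history_kernel_exists (lam : probability state R) : exists lam' :
  probability state R,
  forall f : state -> \bar R, measurable_fun setT f -> (forall z, 0 <= f z) ->
    \int[lam']_z f z = \int[lam]_z remember f z.
Proof.
have [TQ hTQ] := choice transition_exists.
have mr (z : state) : measurable_fun setT
    (fun w : borel X * borel Y => (interleave (code eY w.2) z.1, w.1) : state).
  exact: (measurableT_comp measurable_remember (measurable_pair1 z)).
pose J (z : state) : probability state R := push_probability (mr z) (TQ z.2).
have JE z f : measurable_fun setT f -> (forall z, 0 <= f z) ->
  \int[J z]_w f w = remember f z.
  move=> mf f0; rewrite integral_push// hTQ//.
  exact: (measurableT_comp mf (mr z)).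
have mJ U : measurable U -> measurable_fun setT (fun z => J z U).
  move=> mU; rewrite (_ : (fun z => _) = remember (fun z => (\1_U z)%:E)).
    apply: measurable_remember_fun.
      by apply/measurable_EFinP; exact: measurable_indic.
    by move=> z; rewrite lee_fin.
  apply/funext => z; rewrite -JE//; last by apply/measurable_EFinP;
    exact: measurable_indic.
  by rewrite integral_indic// setIT.
have [lam' [_ h]] := mixture_exists lam mJ.
by exists lam' => f mf f0; rewrite h//; apply: eq_integral => z _; exact: JE.
Qed.

(** Old bit j moves to position 2j + 1 > j, so [k] bits of the old history determine [k.+1] bits of
    the new one. This gain of one bit per step is what makes the initial history forgotten. *)
Lemma truncate_interleave k a b :
  truncate k.+1 (interleave a b) = truncate k.+1 (interleave a (truncate k b)).
Proof.
apply/funext => n; rewrite /truncate /interleave; case: ltnP => //= nk.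
case: ifP => // on; suff -> : (n./2 < k)%N by [].
case: n on nk => // n _; rewrite ltnS; apply: leq_trans.
by rewrite ltn_half_double -addnn -[X in (X < _)%N]addn0 ltn_add2l.
Qed.

Let cut k (z : state) : state := (truncate k z.1, z.2).

Let measurable_cut k : measurable_fun setT (cut k).
Proof.
apply/measurable_fun_pairP; split; last exact: measurable_snd.
exact: (measurableT_comp (measurable_truncate k) measurable_fst).
Qed.

Let remember_cut k f z : remember (f \o cut k.+1) z = remember (f \o cut k.+1)
  (cut k z).
Proof.
apply: eq_integral => x1 _; apply: eq_integral => y _ /=.
by rewrite /cut/= truncate_interleave.
Qed.

Lemma stationary_history_exists : exists lam : probability state R,
  forall f : state -> \bar R, measurable_fun setT f -> (forall z, 0 <= f z) ->
    \int[lam]_z f z = \int[lam]_z \int[T z.2]_x1 \int[Q x1]_y f (interleave (code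
      eY y) z.1, x1).
Proof.
have [hX [D cD dD]] := pX; have [e de] := dense_sequence_exists cD dD.
have [step hstep] := choice history_kernel_exists.
pose h0 : bits := fun=> false.
have mh0 : measurable_fun setT (fun x : borel X => (h0, x) : state).
  by apply/measurable_fun_pairP; split; [exact: measurable_cst|exact: measurable_id].
pose lamn n := iter n step (push_probability mh0 mu).
have lamS n (f : state -> \bar R) : measurable_fun setT f -> (forall z, 0 <= f z) ->
    \int[lamn n.+1]_z f z = \int[lamn n]_z remember f z.
  by move=> mf f0; exact: hstep.
have muT (f : borel X -> \bar R) : measurable_fun setT f -> (forall x, 0 <= f x) ->
    \int[mu]_x f x = \int[mu]_x \int[T x]_x1 f x1.
  move=> mf f0; have [p [p1 p2]] := kernel_step_exists T mu.
  by rewrite -p2//; apply: eq_probability_integral => A mA; rewrite p1// mu_inv.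
have mTf (f : borel X -> \bar R) : measurable_fun setT f -> (forall x, 0 <= f x) ->
    measurable_fun setT (fun x : borel X => \int[T x]_x1 f x1).
  move=> mf f0; apply: measurable_fun_integral_kernel => // U mU.
  exact: measurable_kernel.
have lawX n (f : borel X -> \bar R) : measurable_fun setT f -> (forall x, 0 <= f x) ->
    \int[lamn n]_z f z.2 = \int[mu]_x f x.
  elim: n f => [|n IH] f mf f0.
    rewrite integral_push//; exact: (measurableT_comp mf measurable_snd).
  rewrite lamS//; last exact: (measurableT_comp mf measurable_snd).
  rewrite (muT f mf f0) -(IH (fun x => \int[T x]_x1 f x1)).
  - apply: eq_integral => z _; apply: eq_integral => x1 _ /=.
    exact: (integral_probability_cst (kernel_at Q x1)).
  - exact: mTf.
  - by move=> x; apply: integral_ge0 => x1 _; exact: f0.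
have mcut (f : state -> \bar R) k : measurable_fun setT f ->
  measurable_fun setT (f \o cut k).
  by move=> mf; exact: (measurableT_comp mf (measurable_cut k)).
(* [cut 0] resets the history to [h0], so only the hidden state is left, and its law is [mu] at all
   times. For [k.+1], one transition reduces both sides to [k] bits. *)
have lamn_cut k n (f : state -> \bar R) : (k <= n)%N -> measurable_fun setT f ->
  (forall z, 0 <= f z) ->
    \int[lamn n]_z f (cut k z) = \int[lamn k]_z f (cut k z).
  elim: k n f => [|k IH] n f kn mf f0.
    have E m : \int[lamn m]_z f (cut 0 z) = \int[mu]_x f (h0, x).
      by rewrite -(lawX m (fun x => f (h0, x)))//; exact: (measurableT_comp mf mh0).
    by rewrite !E.
  case: n kn => // n; rewrite ltnS => kn.
  have fc0 z : 0 <= (f \o cut k.+1) z by exact: f0.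
  have mfc := mcut f k.+1 mf.
  rewrite (lamS n _ mfc fc0) (lamS k _ mfc fc0).
  under eq_integral do rewrite remember_cut.
  under [RHS]eq_integral do rewrite remember_cut.
  apply: (IH n (remember (f \o cut k.+1)) kn) => [|z]; last exact: remember_ge0.
  exact: measurable_remember_fun.
(* The hidden state is coded too, so that the limit can be taken on [bits] by [ultralimit_bits]. *)
pose enc (z : state) : bits := interleave (code e z.2) z.1.
pose dec (c : bits) : state := (odd_part c, decode e (even_part c)).
have menc : measurable_fun setT enc.
  apply: measurable_fun_interleave; last exact: measurable_fst.
  exact: (measurableT_comp (measurable_code e) measurable_snd).
have mdec : measurable_fun setT dec.
  apply/measurable_fun_pairP; split; first exact: measurable_odd_part.
  exact: (measurableT_comp (measurable_decode e) measurable_even_part).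
have encK z : dec (enc z) = z.
  by case: z => h x; rewrite /dec /enc odd_interleave even_interleave codeK.
pose cutb k (c : bits) := interleave (even_part c) (truncate k (odd_part c)).
have mcutb k : measurable_fun setT (cutb k).
  apply: measurable_fun_interleave; first exact: measurable_even_part.
  exact: (measurableT_comp (measurable_truncate k) measurable_odd_part).
have cutb_enc k z : cutb k (enc z) = enc (cut k z).
  by rewrite /cutb /enc odd_interleave even_interleave.
have dec_cutb k c : dec (cutb k c) = cut k (dec c).
  by rewrite /cutb /dec odd_interleave even_interleave.
(* [cutb] moves no bit: it only resets some of them to [false]. *)
have dep_cutb k m B : depends_below m B -> depends_below m (cutb k @^-1` B).
  move=> dB c c' cc'; apply: dB => i im;
    rewrite /cutb /interleave /even_part /odd_part /truncate.
  have id : (odd i + i./2.*2)%N = i := odd_double_half i.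
  case: ifP id => oi id; first by congr (_ && _); apply: cc';
    rewrite -[in X in (X <= _)%N]id in im *.
  by apply: cc'; rewrite -[in X in (X <= _)%N]id in im *.
have [U [UU ooU]] := ultraFilterLemma (F := \oo) _.
have PU : ProperFilter U := @ultra_proper _ _ UU.
pose rho N := push_probability menc (lamn N).
have [nu hnu] := ultralimit_bits UU rho.
have integral_1 d' (Z : measurableType d') (p : probability Z R) (A : set Z) :
    measurable A -> p A = \int[p]_z (\1_A z)%:E.
  by move=> mA; rewrite integral_indic// setIT.
(* The masses of a cylinder under the cut laws are constant for N at least [k], hence equal to their
   limit: [nu] is the projective limit of the laws [rho N]. *)
have nu_cut k A : measurable A ->
    push_probability (mcutb k) nu A = push_probability (mcutb k) (rho k) A.
  apply: bits_measure_eq => s; set B := cutb k @^-1` cylinder s.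
  suff : nu B = rho k B by [].
  have dB : depends_below (size s) B by apply: dep_cutb; exact: depends_cylinder.
  have mB : measurable B := measurable_depends dB.
  have rhoE N : (k <= N)%N -> rho N B = rho k B.
    move=> kN.
    have E M : rho M B = \int[lamn M]_z (\1_(cylinder s) (enc (cut k z)))%:E.
      rewrite integral_1// integral_push//.
      - by apply: eq_integral => z _; rewrite /B -cutb_enc !indicE; congr (_%:R%:E).
      - by apply/measurable_EFinP; exact: measurable_indic.
    rewrite !E; apply: (lamn_cut k N (fun z => (\1_(cylinder s) (enc z))%:E)) => //.
      apply/measurable_EFinP; apply: (measurableT_comp _ menc).
      by apply: measurable_indic; exact: measurable_cylinder.
  have h1 := hnu _ _ dB.
  have h2 : (fun N => fine (rho N B)) @ U --> fine (rho k B).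
    suff : (fun N => fine (rho N B)) @ \oo --> fine (rho k B) by move=> h V /h;
      exact: ooU.
    by apply: cvg_near_cst; exists k => // N /= kN; rewrite rhoE.
  rewrite -(@fineK _ (nu B)) ?fin_num_measure// -(@fineK _ (rho k B))
    ?fin_num_measure//.
  by congr (_%:E); rewrite -(cvg_lim (@Rhausdorff R) h1) -(cvg_lim (@Rhausdorff R) h2).
pose lam := push_probability mdec nu.
have lam_cut k (f : state -> \bar R) : measurable_fun setT f -> (forall z, 0 <= f z) ->
    \int[lam]_z f (cut k z) = \int[lamn k]_z f (cut k z).
  move=> mf f0.
  have mfd : measurable_fun setT (f \o dec) by exact: (measurableT_comp mf mdec).
  transitivity (\int[push_probability (mcutb k) nu]_c (f \o dec) c).
    rewrite (integral_push mdec nu (mcut f k mf) (fun y => f0 _)).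
    rewrite (integral_push (mcutb k) nu mfd (fun y => f0 _)).
    by apply: eq_integral => c _ /=; rewrite dec_cutb.
  rewrite (eq_probability_integral _ (nu_cut k)) (integral_push _ _ mfd (fun y =>
    f0 _)).
  rewrite (integral_push menc (lamn k) (measurableT_comp mfd (mcutb k)) (fun y =>
    f0 _)).
  by apply: eq_integral => z _ /=; rewrite cutb_enc encK.
exists lam => f mf f0; have [lam' hlam'] := history_kernel_exists lam.
suff lamE A : measurable A -> lam A = lam' A.
  by rewrite (eq_probability_integral f lamE) hlam'.
move=> mA.
have mpre : measurable (dec @^-1` A) by rewrite -[X in measurable X]setTI;
  exact: (mdec measurableT).
have preE : enc @^-1` (dec @^-1` A) = A by apply/seteqP; split => z /=; rewrite encK.
suff : push_probability menc lam (dec @^-1` A)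
  = push_probability menc lam' (dec @^-1` A).
  by rewrite -[in lam A]preE -[in lam' A]preE.
apply: bits_measure_eq => // s.
suff : lam (enc @^-1` cylinder s) = lam' (enc @^-1` cylinder s) by [].
set k := size s; set g := fun z => (\1_(cylinder s) (enc z))%:E : \bar R.
have mC := measurable_cylinder s.
have mg : measurable_fun setT g.
  by apply/measurable_EFinP; apply: (measurableT_comp _ menc); exact: measurable_indic.
have g0 z : 0 <= g z by rewrite lee_fin.
have mE : measurable (enc @^-1` cylinder s) by rewrite -[X in measurable X]setTI;
  exact: (menc measurableT).
(* A cylinder of length [k] reads history bits of index below [k] only. It is nevertheless cut at
   [k.+1], the form to which [remember_cut] applies. *)
have gE (p : probability state R) : p (enc @^-1` cylinder s) = \int[p]_z g (cut k.+1 z).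
  rewrite integral_1//; apply: eq_integral => z _; rewrite /g !indicE;
    congr ((nat_of_bool _)%:R%:E).
  have agree i : (i < k)%N -> enc z i = enc (cut k.+1 z) i.
    move=> ik; rewrite /enc /interleave /cut /truncate/=; case: ifP => // oi.
    suff -> : (i./2 < k.+1)%N by [].
    by clear -ik; lia.
  have dC := @depends_cylinder s.
  apply/idP/idP; rewrite !inE => h; apply: dC h => i ik; first exact: agree.
  by rewrite agree.
have gc0 z : 0 <= (g \o cut k.+1) z by exact: g0.
have mgc := mcut g k.+1 mg.
(* On [k.+1] bits [lam] coincides with [lamn k.+1], one step after [lamn k], and [lam'] is one step
   after [lam]. That step reads only [k] bits, on which [lam] and [lamn k] coincide. *)
rewrite !gE (lam_cut _ _ mg g0) (lamS k _ mgc gc0) (hlam' _ mgc gc0).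
under eq_integral do rewrite remember_cut.
under [RHS]eq_integral do rewrite remember_cut.
rewrite (lam_cut k (remember (g \o cut k.+1)))//; first exact: measurable_remember_fun.
by move=> z; exact: remember_ge0.
Qed.

End stationary_history.

(** * The invariant law of the filter *)

(** Probabilities that agree on measurable sets have the same image under [weak_eval], and Borel
    sets of an initial topology are generated by preimages under that map. *)
Lemma borel_wprobability_saturated (R : realType) (X : ptopologicalType)
    (p q : wprobability X R) (D : set (borel (wprobability X R))) :
  (forall A : set (borel X), measurable A ->
     (p : probability (borel X) R) A = (q : probability (borel X) R) A) ->
  measurable D -> D p = D q.
Proof.
move=> pq.
have weq : weak_eval p = weak_eval q.
  apply/funext => f; rewrite /weak_eval /Rintegral; congr fine.
  exact: eq_probability_integral.
apply: (@smallest_sub _ _ _ [set D : set (borel (wprobability X R)) | D p = D q])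
  => [|_ [B oB <-]].
- split => [//|A /= e|F /= e].
    by rewrite /setD /= e.
  by apply/propext; split => -[n _ Fn]; exists n => //; move: Fn; rewrite e.
- by rewrite /= /preimage/= weq.
Qed.

(** Countably many tests decide equality on all Borel sets; this turns equalities that hold almost
    surely for each event into one that holds almost surely for all of them. *)
Lemma probability_code_eq (R : realType) (X : completePseudoMetricType R) (e : nat -> X)
    (p q : probability (borel X) R) : hausdorff_space X -> dense (range e) ->
  (forall s, p (code e @^-1` cylinder s) = q (code e @^-1` cylinder s)) ->
  forall A, measurable A -> p A = q A.
Proof.
move=> hX de pq A mA.
have mB : measurable (decode e @^-1` A).
  by rewrite -[X in measurable X]setTI; exact: measurable_decode.
have E : code e @^-1` (decode e @^-1` A) = A.
  by apply/seteqP; split => x /=; rewrite codeK.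
suff : push_probability (measurable_code e) p (decode e @^-1` A) =
       push_probability (measurable_code e) q (decode e @^-1` A).
  by rewrite /= /distribution /pushforward /= E.
by apply: bits_measure_eq => // s; exact: pq.
Qed.

Section invariant_filter.
Context (R : realType) (X Y : completePseudoMetricType R).
Hypotheses (pX : polish X) (pY : polish Y).
Variables (T : R.-pker (borel X) ~> (borel X)) (Q : R.-pker (borel X) ~> (borel Y)).
Variable F : {mfun (borel (wprobability X R) * borel Y)%type >->
  borel (wprobability X R)}.
Hypothesis update_F : filter_update T Q F.
Local Open Scope ereal_scope.

(** The inner integrals are jointly measurable in (p, x), and they are integrated against [p]
    itself, which depends measurably on the point [p] because evaluations are measurable. *)
Lemma measurable_filter_kernel D : measurable D ->
  measurable_fun setT (filter_kernel T Q F ^~ D).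
Proof.
move=> mD; have [hX [D' cD dD]] := pX; have [e de] := dense_sequence_exists cD dD.
pose W := borel (wprobability X R).
pose f (z : W * borel X) := \int[T z.2]_x1 \int[Q x1]_y (\1_D (F (z.1, y)))%:E.
have mf : measurable_fun setT f.
  apply: (@measurable_two_step_integral _ _ _ T Q _ (W * borel X)%type snd
    (fun w => (\1_D (F (w.1.1, w.2.2)))%:E)) => //.
  apply/measurable_EFinP; apply: (measurableT_comp (measurable_indic _)) => //.
  apply: (measurableT_comp (measurable_funPT F)).
  apply/measurable_fun_pairP; split.
    exact: (measurableT_comp measurable_fst measurable_fst).
  exact: (measurableT_comp measurable_snd measurable_snd).
have f0 z : 0 <= f z by apply: integral_ge0 => x1 _; apply: integral_ge0 => y _;
  rewrite lee_fin.
have mk A : measurable A -> measurable_fun setT (fun p : W =>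
  (p : probability (borel X) R) A).
  by move=> mA; exact: (wprobability_eval_measurable de mA).
rewrite (_ : filter_kernel T Q F ^~ D = fun p : W =>
  \int[(p : probability (borel X) R)]_x f (p, x)).
  exact: (measurable_family_integral mk mf f0).
apply/funext => p; apply: eq_integral => x _; apply: eq_integral => x1 _.
rewrite (_ : (fun y => _) = EFin \o \1_[set y | D (F (p, y))]).
  rewrite integral_indic// ?setIT// -[X in measurable X]setTI.
  exact: (measurableT_comp (measurable_funPT F) (measurable_pair1 p)).
by apply/funext => y /=; rewrite !indicE.
Qed.

Variable mu : probability (borel X) R.
Hypothesis mu_inv : forall A, measurable A -> mu A = \int[mu]_x T x A.

Lemma filter_kernel_invariant : exists M : probability (borel (wprobability X R)) R,
  invariant_probability (filter_kernel T Q F) M.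
Proof.
have [hX [DX cDX dDX]] := pX; have [e de] := dense_sequence_exists cDX dDX.
have [hY [DY cDY dDY]] := pY; have [eY deY] := dense_sequence_exists cDY dDY.
pose W := borel (wprobability X R).
have [lam lam_inv] := stationary_history_exists pX Q eY mu_inv.
have [g [mg hg]] := disintegration lam pX.
set zeta := push_probability measurable_fst lam in hg.
pose g1 (h : bits) : W := g h.
have mg1 : measurable_fun setT g1 by exact: (measurable_fun_wprobability de mg).
(* One step of the filter, from the history before the last observation. *)
pose g2 (h : bits) : W := F (g1 (odd_part h), decode eY (even_part h)).
have mg2 : measurable_fun setT g2.
  apply: (measurableT_comp (measurable_funPT F)); apply/measurable_fun_pairP; split.
    exact: (measurableT_comp mg1 measurable_odd_part).
  exact: (measurableT_comp (measurable_decode eY) measurable_even_part).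
have g2E y h : g2 (interleave (code eY y) h) = F (g1 h, y).
  by rewrite /g2 odd_interleave even_interleave codeK.
have mev A : measurable A -> measurable_fun setT (fun p : W =>
  (p : probability (borel X) R) A).
  by move=> mA; exact: (wprobability_eval_measurable de mA).
have mgA A : measurable A -> measurable_fun setT (fun h =>
  (g2 h : probability (borel X) R) A).
  by move=> mA; exact: (measurableT_comp (mev A mA) mg2).
have zetaE (f : bits -> \bar R) : measurable_fun setT f -> (forall h, 0 <= f h) ->
    \int[zeta]_h f h = \int[lam]_z f z.1.
  by move=> mf f0; exact: integral_push.
have mstep h : measurable_fun setT (fun y : borel Y => interleave (code eY y) h).
  by apply: measurable_fun_interleave; [exact: measurable_code|exact: measurable_cst].
have mQ (f : borel Y -> \bar R) : measurable_fun setT f -> (forall y, 0 <= f y) ->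
    measurable_fun setT (fun x1 : borel X => \int[Q x1]_y f y).
  move=> mf f0; apply: measurable_fun_integral_kernel => // V mV;
    exact: measurable_kernel.
have mF p : measurable_fun setT (fun y : borel Y => F (p, y) : W).
  exact: (measurableT_comp (measurable_funPT F) (measurable_pair1 p)).
have mW : measurable_fun setT (fun w : (bits * borel X) * (borel X * borel Y) =>
    (interleave (code eY w.2.2) w.1.1, w.2.1) : bits * borel X) :=
      measurable_remember eY.
(* By stationarity of [lam], both sides are P(X_1 in A, h' in C), where h' is the
   history after one step. *)
have key A C : measurable A -> measurable C ->
    \int[zeta]_(h in C) g h A = \int[zeta]_(h in C) (g2 h : probability (borel X) R) A.
  move=> mA mC.
  have m1C : measurable_fun setT (fun h : bits => (\1_C h)%:E : \bar R).
    by apply/measurable_EFinP; exact: measurable_indic.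
  have m1A : measurable_fun setT (fun x : borel X => (\1_A x)%:E : \bar R).
    by apply/measurable_EFinP; exact: measurable_indic.
  pose f1 (z : bits * borel X) : \bar R := (\1_C z.1)%:E * (\1_A z.2)%:E.
  pose f2 (z : bits * borel X) : \bar R := (\1_C z.1)%:E * (g2 z.1 :
    probability (borel X) R) A.
  have mf1 : measurable_fun setT f1.
    apply: emeasurable_funM; first exact: (measurableT_comp m1C measurable_fst).
    exact: (measurableT_comp m1A measurable_snd).
  have mf2 : measurable_fun setT f2.
    apply: emeasurable_funM; first exact: (measurableT_comp m1C measurable_fst).
    exact: (measurableT_comp (mgA A mA) measurable_fst).
  have f10 z : 0 <= f1 z by rewrite mule_ge0// lee_fin.
  have f20 z : 0 <= f2 z by rewrite mule_ge0// lee_fin.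
  have e1 : \int[zeta]_(h in C) g h A = \int[lam]_z f1 z.
    rewrite hg// integral_mkcond; apply: eq_integral => h _; rewrite patchE.
    rewrite /f1 /=; case: (boolP (h \in C)) => hC.
      under eq_integral do rewrite indicE hC mul1e.
      by rewrite integral_indic// setIT.
    under eq_integral do rewrite indicE (negbTE hC) mul0e.
    by rewrite integral0.
  have e2 : \int[zeta]_(h in C) (g2 h : probability (borel X) R) A = \int[lam]_z f2 z.
    rewrite -(zetaE (fun h => (\1_C h)%:E * (g2 h : probability (borel X) R) A)).
    - rewrite integral_mkcond; apply: eq_integral => h _; rewrite patchE indicE.
      by case: (h \in C); rewrite ?mul1e ?mul0e.
    - apply: emeasurable_funM => //; exact: mgA.
    - by move=> h; rewrite mule_ge0// lee_fin.
  pose R1 (z : bits * borel X) :=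
    \int[T z.2]_x1 \int[Q x1]_y f1 (interleave (code eY y) z.1, x1).
  pose R2 (z : bits * borel X) :=
    \int[T z.2]_x1 \int[Q x1]_y f2 (interleave (code eY y) z.1, x1).
  have mR1 : measurable_fun setT R1.
    apply: (@measurable_two_step_integral _ _ _ T Q _ _ snd (fun w =>
      f1 (interleave (code eY w.2.2) w.1.1, w.2.1))) => //.
    exact: (measurableT_comp mf1 mW).
  have mR2 : measurable_fun setT R2.
    apply: (@measurable_two_step_integral _ _ _ T Q _ _ snd (fun w =>
      f2 (interleave (code eY w.2.2) w.1.1, w.2.1))) => //.
    exact: (measurableT_comp mf2 mW).
  have R10 z : 0 <= R1 z by apply: integral_ge0 => x1 _; exact: integral_ge0.
  have R20 z : 0 <= R2 z by apply: integral_ge0 => x1 _; exact: integral_ge0.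
  have i1 : \int[lam]_z f1 z = \int[lam]_z R1 z := lam_inv f1 mf1 f10.
  have i2 : \int[lam]_z f2 z = \int[lam]_z R2 z := lam_inv f2 mf2 f20.
  (* One transition is run on both sides, and the earlier hidden state is integrated with law [g h].
     For fixed [h], what remains is [filter_update] with prior [g h] and the section [Ch] of [C] at
     the past [h]. *)
  rewrite e1 i1 e2 i2 (hg R1 mR1 R10) (hg R2 mR2 R20).
  apply: eq_integral => h _; rewrite /R1 /R2 /=.
  pose Ch : set (borel Y) := [set y | C (interleave (code eY y) h)].
  have mCh : measurable Ch by rewrite -[X in measurable X]setTI; exact: mstep.
  have := update_F (g h) mA mCh => hup.
  transitivity (\int[g h]_x \int[T x]_(x1 in A) Q x1 Ch).
    apply: eq_integral => x _; rewrite [RHS]integral_mkcond; apply: eq_integral => x1 _.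
    rewrite patchE /f1 /=.
    transitivity (\int[Q x1]_y ((\1_A x1)%:E * (\1_Ch y)%:E)).
      by apply: eq_integral => y _; rewrite muleC.
    rewrite indicE; case: (x1 \in A) => /=.
      by under eq_integral do rewrite mul1e; rewrite integral_indic// setIT.
    by under eq_integral do rewrite mul0e; rewrite integral0.
  rewrite -hup; apply: eq_integral => x _; apply: eq_integral => x1 _.
  rewrite integral_mkcond; apply: eq_integral => y _; rewrite patchE /f2 /= g2E.
  rewrite indicE (_ : (interleave (code eY y) h \in C) = (y \in Ch)).
    by case: (y \in Ch); rewrite ?mul1e ?mul0e.
  by apply/idP/idP; rewrite !inE.
have aeA A : measurable A -> {ae zeta, forall h, g h A = (g2 h :
  probability (borel X) R) A}.
  move=> mA.
  have : ae_eq zeta setT (fun h => g h A) (fun h => (g2 h : probability (borel X) R) A).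
    apply: integral_ae_eq => //.
    - apply/integrableP; split; first exact: mg.
      apply: (@le_lt_trans _ _ (\int[zeta]_h 1));
        last by rewrite integral_probability_cst ltry.
      apply: ge0_le_integral => //.
      + by apply: measurableT_comp => //; exact: mg.
      + by move=> h _; rewrite gee0_abs// probability_le1.
    - exact: mgA.
    - by move=> C _ mC; exact: key.
  by apply: filterS => h; exact.
have aeg : {ae zeta, forall h, forall A, measurable A ->
  g h A = (g2 h : probability (borel X) R) A}.
  have : {ae zeta, forall h, forall s, g h (code e @^-1` cylinder s) =
      (g2 h : probability (borel X) R) (code e @^-1` cylinder s)}.
    apply: ae_forall_countable => s; apply: aeA; rewrite -[X in measurable X]setTI.
    by apply: measurable_code => //; exact: measurable_cylinder.
  by apply: filterS => h; exact: probability_code_eq.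
(* The values of [g1] and [g2] almost surely agree on measurable sets, perhaps without being equal;
   as [D] is saturated, it still contains both or neither. *)
have aeD D : measurable D -> zeta (g1 @^-1` D) = zeta (g2 @^-1` D).
  move=> mD.
  have m1 : measurable (g1 @^-1` D) by rewrite -[X in measurable X]setTI; exact: mg1.
  have m2 : measurable (g2 @^-1` D) by rewrite -[X in measurable X]setTI; exact: mg2.
  rewrite -[g1 @^-1` D]setIT -[g2 @^-1` D]setIT -!integral_indic//.
  apply: ae_eq_integral => //; try by apply/measurable_EFinP; exact: measurable_indic.
  apply: filterS aeg => h hh _; rewrite !indicE; congr ((nat_of_bool _)%:R%:E).
  have := borel_wprobability_saturated hh mD => E.
  by apply/idP/idP; rewrite !inE /= /g1 E.
exists (push_probability mg1 zeta) => D mD.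
have mK := measurable_filter_kernel mD.
have K0 p : 0 <= filter_kernel T Q F p D.
  by apply: integral_ge0 => x _; apply: integral_ge0.
rewrite (integral_push mg1 zeta mK K0).
(* Stationarity is now applied to the law of [g2]: on a history extended by [y] it equals
   [F (g1 h, y)], and the disintegration gives the hidden state law [g h], which is the law used by
   [filter_kernel] at [g1 h]. *)
transitivity (zeta (g2 @^-1` D)); first exact: aeD.
have m2 : measurable (g2 @^-1` D) by rewrite -[X in measurable X]setTI; exact: mg2.
pose f (z : bits * borel X) : \bar R := (\1_(g2 @^-1` D) z.1)%:E.
have mf : measurable_fun setT f.
  apply/measurable_EFinP; apply: (measurableT_comp _ measurable_fst).
  exact: measurable_indic.
have f0 z : 0 <= f z by rewrite lee_fin.
transitivity (\int[lam]_z f z).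
  rewrite -(zetaE (fun h => (\1_(g2 @^-1` D) h)%:E)) ?integral_indic ?setIT//.
  by apply/measurable_EFinP; exact: measurable_indic.
pose R0 (z : bits * borel X) :=
  \int[T z.2]_x1 \int[Q x1]_y f (interleave (code eY y) z.1, x1).
have mR0 : measurable_fun setT R0.
  apply: (@measurable_two_step_integral _ _ _ T Q _ _ snd (fun w =>
    f (interleave (code eY w.2.2) w.1.1, w.2.1))) => //.
  exact: (measurableT_comp mf mW).
have R00 z : 0 <= R0 z by apply: integral_ge0 => x1 _; exact: integral_ge0.
have i0 : \int[lam]_z f z = \int[lam]_z R0 z := lam_inv f mf f0.
rewrite i0 (hg R0 mR0 R00).
apply: eq_integral => h _; apply: eq_integral => x _; apply: eq_integral => x1 _ /=.
rewrite /f /=.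
rewrite (_ : (fun y => _) = EFin \o \1_[set y | D (F (g1 h, y))]).
  by rewrite integral_indic// ?setIT// -[X in measurable X]setTI; exact: mF.
apply/funext => y /=; rewrite !indicE; congr ((nat_of_bool _)%:R%:E).
by apply/idP/idP; rewrite !inE /= g2E.
Qed.

End invariant_filter.

(** The Markov property at time 0, integrated over the sure event, expresses the law of X_1 through
    that of X_0; stationarity with shift 1 identifies the two laws. *)
Lemma stationary_marginal_invariant (R : realType) (X : ptopologicalType)
    (d : measure_display) (Omega : measurableType d) (P : probability Omega R)
    (T : R.-pker (borel X) ~> (borel X)) (Xt : int -> {RV P >-> borel X}) :
  markov_chain P T Xt -> stationary P Xt ->
  forall A, measurable A ->
    (distribution P (Xt 0%R) A = \int[distribution P (Xt 0%R)]_x T x A)%E.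
Proof.
move=> mc st A mA; rewrite ge0_integral_distribution//; last exact: measurable_kernel.
have pastT : past_sigma Xt 0 setT.
  by rewrite -setC0; apply: sigma_algebraC; exact: sigma_algebra0.
have [_ /(_ _ pastT)] := mc 0 A mA.
rewrite setTI => ->; have := st 1 [:: 0] (fun=> A) (fun=> mA).
have -> : [set` [:: 0 : int]] = [set 0] by apply/seteqP; split=> t /=;
  rewrite inE => /eqP.
by rewrite !bigcap_set1 => ->.
Qed.

Unset Implicit Arguments.
Set Strict Implicit.
Set Printing Implicit Defensive.

Theorem corollary1 (R : realType)
  (X Y U : completePseudoMetricType R)
  (polishX : polish X) (polishY : polish Y) (polishU : polish U)
  (dW : measure_display) (W : measurableType dW)
  (d : measure_display) (Omega : measurableType d) (P : probability Omega R)
  (T : R.-pker (borel X) ~> (borel X)) (Q : R.-pker (borel X) ~> (borel Y))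
  (G : {mfun (borel X * W)%type >-> borel Y})
  (Xt : int -> {RV P >-> borel X}) (Vt : int -> {RV P >-> W})
  (Yt : int -> {RV P >-> borel Y})
  (model : observed_markov_chain T Q G Xt Vt Yt)
  (pit : int -> {RV P >-> borel (wprobability X R)})
  (filter_pit : filter_process Xt Yt pit)
  (F : {mfun (borel (wprobability X R) * borel Y)%type
         >-> borel (wprobability X R)})
  (update_F : filter_update T Q F)
  (hyp :
    stationary P Xt \/
    [/\ [/\ compact [set: X], compact [set: Y] & compact [set: U]],
        weakly_continuous Q,
        weakly_continuous T,
        stationary P Xt \/ invariant_continuous_smoother Xt Yt
      & filter_past_measurable Yt pit]) :
  exists mu : probability (borel (wprobability X R)) R,
    invariant_probability (filter_kernel T Q F) mu.
Proof.
have [mu mu_inv] : exists mu : probability (borel X) R,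
    forall A, measurable A -> (mu A = \int[mu]_x T x A)%E.
  have stat : stationary P Xt -> exists mu : probability (borel X) R,
      forall A, measurable A -> (mu A = \int[mu]_x T x A)%E.
    move=> st; exists (distribution P (Xt 0)).
    exact: stationary_marginal_invariant (omc_markov model) st.
  case: hyp => [|[[cX _ _] _ wT _ _]]; first exact: stat.
  exact: krylov_bogoliubov.
exact: (@filter_kernel_invariant R X Y polishX polishY T Q F update_F mu mu_inv).
Qed.
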